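(* An $AW^*$-algebra $\mathcal{A}$ is almost $*$-clean if and only if $\mathcal{A}$ is finite.
   Context: An $AW^*$-algebra is a $C^*$-algebra such that (A) in the partially ordered set of projections (self-adjoint idempotents), any set of orthogonal projections has a least upper bound; and (B) any maximal commutative self-adjoint subalgebra is generated by its projections. It has an identity $I$. Projections $E,F\in\mathcal{A}$ are equivalent, $E\sim F$, if there is a partial isometry $V\in\mathcal{A}$ with $V^*V=E$ and $VV^*=F$. A projection is finite if it is not equivalent to any proper subprojection of itself; $\mathcal{A}$ is finite if $I$ is finite. A $*$-ring is almost $*$-clean if every element is the sum of a non-zero-divisor and a projection, where a non-zero-divisor is an element $a$ that is neither a left nor a right zero divisor ($ax=0$ implies $x=0$, and $xa=0$ implies $x=0$). *)

(* Defs.v *)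
From HB Require Import structures.
From mathcomp Require Import all_boot all_order all_algebra.
From mathcomp Require Import complex.
From mathcomp Require Import all_classical all_reals all_analysis.

Set Implicit Arguments.
Unset Strict Implicit.
Unset Printing Implicit Defensive.

Import Order.TTheory GRing.Theory Num.Theory.
Import numFieldNormedType.Exports.

Local Open Scope classical_set_scope.
Local Open Scope ring_scope.

HB.mixin Record PzRing_isStarRing A & GRing.PzRing A := {
  adj : A -> A;
  adjK : involutive adj;
  adjD : {morph adj : x y / x + y};
  adjM : forall x y : A, adj (x * y) = adj y * adj x
}.

#[short(type="starRingType")]
HB.structure Definition StarRing := {A of PzRing_isStarRing A & GRing.PzRing A}.

(* Unital complex C*-algebras. The ring operations are fields of the mixin
   because HB cannot join the library's normed modules with its rings (numDomainType
   is already such a join, with the norm valued in the ring itself); see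
   cstar_ring below for the ring structure. The norm of a normed module over R[i]
   takes its values in R[i]; being nonnegative, these values are real. *)
HB.mixin Record CompleteNormedModule_isCStarAlgebra (R : realType) A
    & CompleteNormedModule R[i] A := {
  cmul : A -> A -> A;
  cone : A;
  cadj : A -> A;
  cmulA : associative cmul;
  cmul1x : left_id cone cmul;
  cmulx1 : right_id cone cmul;
  cmulDl : left_distributive cmul +%R;
  cmulDr : right_distributive cmul +%R;
  cscaleAl : forall (c : R[i]) (x y : A), c *: cmul x y = cmul (c *: x) y;
  cscaleAr : forall (c : R[i]) (x y : A), c *: cmul x y = cmul x (c *: y);
  cadjK : involutive cadj;
  cadjD : {morph cadj : x y / x + y};
  cadjM : forall x y : A, cadj (cmul x y) = cmul (cadj y) (cadj x);
  cadjZ : forall (c : R[i]) (x : A), cadj (c *: x) = Num.conj c *: cadj x;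
  cnormM : forall x y : A, `|cmul x y| <= `|x| * `|y|;
  cstar_norm : forall x : A, `|cmul (cadj x) x| = `|x| ^+ 2
}.

#[short(type="cstarAlgType")]
HB.structure Definition CStarAlgebra (R : realType) :=
  {A of CompleteNormedModule R[i] A & CompleteNormedModule_isCStarAlgebra R A}.

Definition cstar_ring (R : realType) (A : cstarAlgType R) : Type := A.

HB.instance Definition _ (R : realType) (A : cstarAlgType R) :=
  GRing.Zmodule.copy (cstar_ring A) A.
HB.instance Definition _ (R : realType) (A : cstarAlgType R) :=
  GRing.Zmodule_isPzRing.Build (cstar_ring A)
    (@cmulA R A) (@cmul1x R A) (@cmulx1 R A) (@cmulDl R A) (@cmulDr R A).
HB.instance Definition _ (R : realType) (A : cstarAlgType R) :=
  PzRing_isStarRing.Build (cstar_ring A) (@cadjK R A) (@cadjD R A) (@cadjM R A).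

Section StarRings.
Context {A : starRingType}.
Implicit Types (a e f v : A) (S : set A).

Definition selfadjoint a := adj a = a.

Definition projection e := selfadjoint e /\ e * e = e.

Definition proj_le e f := e * f = e.

Definition proj_lub S e :=
  [/\ projection e,
      forall f, S f -> proj_le f e
    & forall g, projection g -> (forall f, S f -> proj_le f g) -> proj_le e g].

Definition partial_isometry v := projection (adj v * v).

Definition proj_equiv e f :=
  exists v, [/\ partial_isometry v, adj v * v = e & v * adj v = f].

Definition finite_projection e :=
  projection e /\
  forall f, projection f -> proj_le f e -> proj_equiv e f -> f = e.

Definition non_zero_divisor a :=
  (forall x, a * x = 0 -> x = 0) /\ (forall x, x * a = 0 -> x = 0).

End StarRings.

Definition almost_star_clean (A : starRingType) :=
  forall a : A, exists b e : A, [/\ non_zero_divisor b, projection e & a = b + e].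

Definition finite_algebra (A : starRingType) := finite_projection (1 : A).

Section AWStar.
Context {R : realType} {A : cstarAlgType R}.
Implicit Types (M N S : set A).

Record selfadjoint_subalgebra M : Prop := SelfadjointSubalgebra {
  subalg0 : M 0;
  subalgD : forall x y, M x -> M y -> M (x + y);
  subalgZ : forall (c : R[i]) x, M x -> M (c *: x);
  subalgM : forall x y, M x -> M y -> M (cmul x y);
  subalg_adj : forall x, M x -> M (cadj x)
}.

Definition commutative_subalgebra M :=
  selfadjoint_subalgebra M /\ (forall x y, M x -> M y -> cmul x y = cmul y x).

Definition maximal_commutative_subalgebra M :=
  commutative_subalgebra M /\
  forall N, commutative_subalgebra N -> M `<=` N -> N = M.

(* "Generated" is meant in the C*-algebraic sense: norm-closed. *)
Definition generated_subalgebra S : set A :=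
  smallest (fun M => selfadjoint_subalgebra M /\ closed M) S.

End AWStar.

Definition orthogonal_lubs (A : starRingType) :=
  forall S : set A,
    (forall e, S e -> projection e) ->
    (forall e f, S e -> S f -> e <> f -> e * f = 0) ->
    exists e, proj_lub S e.

Definition AWstar (R : realType) (A : cstarAlgType R) :=
  orthogonal_lubs (cstar_ring A) /\
  (forall M : set A, maximal_commutative_subalgebra M ->
     M = generated_subalgebra [set e | M e /\ @projection (cstar_ring A) e]).

(* Main.v *)
From HB Require Import structures.
Require Import Defs.
From mathcomp Require Import all_boot all_order all_algebra.
From mathcomp Require Import complex.
From mathcomp Require Import all_classical all_reals all_analysis.

Set Implicit Arguments.
Unset Strict Implicit.
Unset Printing Implicit Defensive.

Import Order.TTheory GRing.Theory Num.Theory.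
Import numFieldNormedType.Exports.

Local Open Scope classical_set_scope.
Local Open Scope ring_scope.

(* A proper isometry v kills almost *-cleanness: if 2v = b + e with e a projection,
   then v* b = 2 - v* e is invertible by a Neumann series, so b is left invertible;
   were b a non-zero-divisor, b and hence v would be invertible.

   Conversely let A be finite. By (A) and (B), A is a Baer *-ring. Given a, let p be
   the least projection whose right ideal J = pA satisfies a x \in J <-> x \in J, and
   put b = a - p. Then (1 - p) a (1 - p) is right injective on 1 - p, and minimality of
   p makes (a - 1) p left injective on p, so b is a non-zero-divisor as soon as one-sided
   injectivity is two-sided in A.

   For the latter, suppose c is right injective and h c = 0 with h <> 0. Since the range
   of c h is orthogonal to h, the polar decomposition of c h can be summed inside A: a
   sum of orthogonal partial isometries w i with orthogonal initial and final spaces is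
   read off the supremum of the projections (p i + g i + w i + (w i)* ) / 2. This gives
   h ~ f := LP(c h) <= 1 - h. Finiteness forces (1 - h - f) c (1 - h) to be injective on
   1 - h, so the construction can be iterated, and infinitely many orthogonal
   equivalent projections contradict finiteness. *)

(** * Star rings *)

Section StarRingBasics.
Context {A : starRingType}.
Implicit Types a b c e f g p s t u v w x y z : A.

Lemma adj0 : adj 0 = 0 :> A.
Proof. by apply: (addrI (adj 0)); rewrite -adjD !addr0. Qed.

Lemma adjN x : adj (- x) = - adj x.
Proof. by apply: (addrI (adj x)); rewrite -adjD !subrr adj0. Qed.

Lemma adjB x y : adj (x - y) = adj x - adj y.
Proof. by rewrite adjD adjN. Qed.

Lemma adj1 : adj 1 = 1 :> A.
Proof. by rewrite -[LHS]mul1r -{1}(adjK 1) -adjM mul1r adjK. Qed.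

Lemma adj_eq0 x : adj x = 0 -> x = 0.
Proof. by move=> x0; rewrite -(adjK x) x0 adj0. Qed.

Lemma compl_mul0 e x : (1 - e) * x = 0 -> e * x = x.
Proof. by rewrite mulrBl mul1r => /eqP; rewrite subr_eq0 => /eqP /esym. Qed.

Lemma adj_proj e : projection e -> adj e = e. Proof. by case. Qed.

Lemma proj_idem e : projection e -> e * e = e. Proof. by case. Qed.

Lemma projection1 : projection (1 : A).
Proof. by split; rewrite ?mul1r // /selfadjoint adj1. Qed.

Lemma proj_leC e f : projection e -> projection f -> e * f = e -> f * e = e.
Proof. by move=> [e1 _] [f1 _] /(congr1 adj); rewrite adjM e1 f1. Qed.

Lemma proj_leR e f : projection e -> projection f -> f * e = e -> e * f = e.
Proof. by move=> [e1 _] [f1 _] /(congr1 adj); rewrite adjM e1 f1. Qed.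

Lemma proj_orthC e f : projection e -> projection f -> e * f = 0 -> f * e = 0.
Proof. by move=> [e1 _] [f1 _] /(congr1 adj); rewrite adjM e1 f1 adj0. Qed.

Lemma projB e f : projection e -> projection f -> f * e = f -> projection (e - f).
Proof.
move=> pe pf fe; have ef := proj_leC pf pe fe.
split; first by rewrite /selfadjoint adjB !adj_proj.
by rewrite mulrBl !mulrBr ef fe !proj_idem // subrr subr0.
Qed.

Lemma projC e : projection e -> projection (1 - e).
Proof. by move=> pe; apply: projB; rewrite ?mulr1 //; exact: projection1. Qed.

Lemma projD e f : projection e -> projection f -> e * f = 0 -> projection (e + f).
Proof.
move=> pe pf ef; have fe := proj_orthC pe pf ef.
split; first by rewrite /selfadjoint adjD !adj_proj.
by rewrite mulrDl !mulrDr ef fe !proj_idem // addr0 add0r.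
Qed.

End StarRingBasics.

(* The equivalence says that the right annihilator of S is the right ideal eA. *)
Definition baer (A : starRingType) := forall S : set A,
  exists e, projection e /\ forall x, (forall s, S s -> s * x = 0) <-> e * x = x.

(** The last clause is minimality in annihilator form: for an upper bound [g], taking [x = 1 - g]
    gives [g * e = e]. It allows identities on [e] to be checked on the members of [S]. *)
Definition is_sup (A : starRingType) (S : set A) e :=
  [/\ projection e, forall f, S f -> e * f = f
    & forall x, (forall f, S f -> x * f = 0) -> x * e = 0].

(** * Supports, suprema and partial isometries in Baer star rings *)

Section BaerStarRings.
Context {A : starRingType}.
Implicit Types a b c e f g p s t u v w x y z : A.
Hypothesis baerA : baer A.

(** If [e] generates the right annihilator of [adj x], then [x = e * x] and [adj x * e = 0]; the
    adjoint of the first identity turns the second into [adj x = 0]. *)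
Lemma adj_mul_eq0 x : adj x * x = 0 -> x = 0.
Proof.
move=> xx; have [e [pe eP]] := baerA [set adj x].
have ex : e * x = x by apply/eP => s ->.
have xe : adj x * e = 0 by apply: (eP e).2; rewrite // proj_idem.
by rewrite -ex -(adjK x) -(adj_proj pe) -adjM xe adj0.
Qed.

Lemma mul_adj_eq0 x : x * adj x = 0 -> x = 0.
Proof.
by move=> xx; apply: adj_eq0; apply: adj_mul_eq0; rewrite adjK.
Qed.

Lemma right_support c :
  exists e, [/\ projection e, c * e = c & forall x, c * x = 0 -> e * x = 0].
Proof.
have [n [pn nP]] := baerA [set c].
have cn : c * n = 0 by apply: (nP n).2; rewrite // proj_idem.
exists (1 - n); split; first exact: projC.
  by rewrite mulrBr cn mulr1 subr0.
by move=> x cx; rewrite mulrBl mul1r (nP x).1 ?subrr // => s ->.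
Qed.

Lemma left_support c :
  exists e, [/\ projection e, e * c = c & forall x, x * c = 0 -> x * e = 0].
Proof.
have [e [pe ce eP]] := right_support (adj c); exists e; split=> //.
  by rewrite -(adjK c) -{1}(adj_proj pe) -adjM ce.
move=> x xc; apply: adj_eq0; rewrite adjM adj_proj //; apply: eP.
by rewrite -adjM xc adj0.
Qed.

(** The supremum is the complement of the projection generating the right annihilator of [S]. *)
Lemma sup_exists (S : set A) :
  (forall e, S e -> projection e) -> exists e, is_sup S e.
Proof.
move=> Sp; have [n [pn nP]] := baerA S; exists (1 - n); split; first exact: projC.
  move=> f Sf; have fn : f * n = 0 by apply: (nP n).2; rewrite ?proj_idem.
  by rewrite mulrBl mul1r (proj_orthC (Sp _ Sf)) // subr0.
move=> x xS; apply: adj_eq0; rewrite adjM adj_proj; last exact: projC.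
rewrite mulrBl mul1r (nP (adj x)).1 ?subrr // => s Ss.
by rewrite -(adj_proj (Sp _ Ss)) -adjM xS // adj0.
Qed.

Lemma piso_source p w : projection p -> adj w * w = p -> w * p = w.
Proof.
move=> pp wp; apply/eqP; rewrite -subr_eq0; apply/eqP/adj_mul_eq0.
rewrite adjB adjM adj_proj // mulrBl !mulrBr !mulrA wp.
by rewrite -(mulrA p (adj w)) wp !proj_idem // !subrr.
Qed.

Lemma piso_range p w : projection p -> adj w * w = p -> projection (w * adj w).
Proof.
move=> pp wp; split; first by rewrite /selfadjoint adjM adjK.
by rewrite mulrA -(mulrA w (adj w)) wp (piso_source pp wp).
Qed.

Lemma piso_rangeK p w : projection p -> adj w * w = p -> w * adj w * w = w.
Proof. by move=> pp wp; rewrite -mulrA wp (piso_source pp wp). Qed.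

End BaerStarRings.

(** * Sums of orthogonal partial isometries *)

Definition half_element (A : starRingType) (k : A) :=
  [/\ k + k = 1, adj k = k & forall x, k * x = x * k].

Section OrthogonalAddition.
Context {A : starRingType}.
Hypothesis baerA : baer A.
Variable k : A.
Hypothesis halfk : half_element k.

(* If p and g are orthogonal, then k (p + g + w + w^* ) is the projection onto the
   graph of the partial isometry w from p to g; the sum of the w i is read off the
   supremum of these projections. *)
Lemma orthogonal_addition (I : Type) (p w : I -> A) (P G : A) :
  (forall i, projection (p i)) -> (forall i, adj (w i) * w i = p i) ->
  (forall i j, i <> j -> p i * p j = 0) ->
  (forall i j, i <> j -> adj (w i) * w j = 0) ->
  (forall i j, p i * w j = 0) ->
  is_sup (range p) P -> is_sup (range (fun i => w i * adj (w i))) G ->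
  exists W, [/\ adj W * W = P, W * adj W = G & forall i, W * p i = w i].
Proof.
case: halfk => k2 kadj kC pp wp porth gorth pw [pP Pp supP] [pG Gp supG].
pose g i := w i * adj (w i).
have pg i : projection (g i) := piso_range baerA (pp i) (wp i).
have wpK i : w i * p i = w i := piso_source baerA (pp i) (wp i).
have gwK i : g i * w i = w i := piso_rangeK baerA (pp i) (wp i).
have pwa i : p i * adj (w i) = adj (w i).
  by rewrite -{2}(wpK i) adjM (adj_proj (pp i)).
have wga i : adj (w i) * g i = adj (w i).
  by rewrite -{2}(gwK i) adjM (adj_proj (pg i)).
have wap i j : adj (w i) * p j = 0.
  by rewrite -(adj_proj (pp j)) -adjM pw adj0.
have pgo i j : p i * g j = 0 by rewrite /g mulrA pw mul0r.
have gpo i j : g i * p j = 0 by rewrite /g -mulrA wap mulr0.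
have ww i j : w i * w j = 0 by rewrite -(wpK i) -mulrA pw mulr0.
have waa i j : adj (w i) * adj (w j) = 0 by rewrite -adjM ww adj0.
have wg i j : w i * g j = 0 by rewrite /g mulrA ww mul0r.
have gwa i j : g i * adj (w j) = 0 by rewrite /g -mulrA waa mulr0.
have pa i : adj (p i) = p i := adj_proj (pp i).
have ga i : adj (g i) = g i := adj_proj (pg i).
have Pa : adj P = P := adj_proj pP.
have Ga : adj G = G := adj_proj pG.
have p2 i : p i * p i = p i := proj_idem (pp i).
have g2 i : g i * g i = g i := proj_idem (pg i).
pose r i := p i + g i + (w i + adj (w i)).
pose s i := p i + g i.
have rr i : r i * r i = r i + r i.
  rewrite {1}/r {1}/r.
  rewrite !mulrDl !mulrDr !(pgo, gpo, ww, waa, wg, gwa, pw, wap, wpK, gwK, pwa, wga, wp, p2, g2).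
  rewrite -/(g i) !(addr0, add0r) /r.
  by rewrite (AC ((2*2)*(2*2)) ((1*3*(4*2))*(8*6*(5*7)))).
have radj i : adj (r i) = r i.
  by rewrite /r !adjD adjK ?pa ?ga [adj _ + w i]addrC.
pose q i := k * r i.
have pq i : projection (q i).
  split; first by rewrite /selfadjoint /q adjM radj kadj kC.
  rewrite /q -mulrA (mulrA (r i)) -kC -mulrA rr mulrDr -mulrDl k2 mul1r //.
have sr i : s i * r i = r i.
  rewrite /r /s mulrDr !mulrDl !mulrDr !(pgo, gpo, pw, gwa, p2, g2, gwK, pwa).
  by rewrite !(addr0, add0r) [_ + w i]addrC.
have srj i j : i <> j -> s i * r j = 0.
  move=> ij; rewrite /r /s mulrDr !mulrDl !mulrDr !(pgo, gpo, pw, gwa, porth) //.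
  rewrite -(pwa j) (mulrA (p i)) porth // mul0r /g !mulrA.
  rewrite -!(mulrA (w i) (adj (w i))) gorth // !(mulr0, mul0r, addr0) //.
have rsr i j : i <> j -> r i * r j = 0.
  move=> ij; rewrite -(radj i) -(sr i) adjM -mulrA.
  suff -> : adj (s i) * r j = 0 by rewrite mulr0.
  by rewrite /s adjD ?pa ?ga srj.
have [|Q [pQ Qq supQ]] := @sup_exists _ baerA (range q).
  by move=> _ [i _ <-].
(* The space of [s i] contains the graph of [w i] and is orthogonal to all other graphs, so it cuts
   the i-th graph projection out of [Q]. *)
have sQ i : s i * Q = q i.
  have : (s i - q i) * Q = 0.
    apply: supQ => _ [j _ <-]; rewrite mulrBl.
    case: (pselect (i = j)) => [<-|ij].
      by rewrite (proj_idem (pq i)) {1}/q mulrA -kC -mulrA sr subrr.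
    rewrite /q mulrA -kC -mulrA srj // mulr0 -mulrA (mulrA (r i)) -kC -mulrA rsr //.
    by rewrite !mulr0 subr0.
  rewrite mulrBl => /eqP; rewrite subr_eq0 => /eqP ->.
  rewrite -[RHS](adj_proj (pq i)) -[in RHS](Qq (q i)); last by exists i.
  by rewrite adjM (adj_proj (pq i)) (adj_proj pQ).
have ps i : p i * s i = p i by rewrite mulrDr p2 pgo addr0.
have gs i : g i * s i = g i by rewrite mulrDr g2 gpo add0r.
have pQi i : p i * Q = k * (p i + adj (w i)).
  rewrite -(ps i) -mulrA sQ /q mulrA -kC -mulrA /r !mulrDr p2 pgo pw pwa.
  by rewrite !mulr0 addr0 add0r.
have gQi i : g i * Q = k * (g i + w i).
  rewrite -(gs i) -mulrA sQ /q mulrA -kC -mulrA /r !mulrDr gpo g2 gwK gwa.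
  by rewrite !mulr0 addr0 add0r.
have Qpi i : Q * p i = k * (p i + w i).
  by rewrite -[LHS]adjK adjM ?pa ?ga (adj_proj pQ) pQi adjM kadj adjD adjK ?pa ?ga kC.
have Qgi i : Q * g i = k * (g i + adj (w i)).
  by rewrite -[LHS]adjK adjM ?pa ?ga (adj_proj pQ) gQi adjM kadj adjD ?pa ?ga kC.
have kk x : k * x + k * x = x by rewrite -mulrDl k2 mul1r.
have GP i : G * p i = 0.
  rewrite -[LHS]adjK adjM ?pa ?ga Ga supG ?adj0 // => _ [j _ <-].
  exact: pgo.
have Pg i : P * g i = 0.
  rewrite -[LHS]adjK adjM Pa (adj_proj (pg i)) supP ?adj0 // => _ [j _ <-].
  exact: gpo.
have gg i : range g (g i) by exists i.
have rp i : range p (p i) by exists i.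
have Gw i : G * w i = w i by rewrite -(gwK i) mulrA Gp.
have Pwa i : P * adj (w i) = adj (w i) by rewrite -(pwa i) mulrA Pp.
(* The corner of a graph projection from initial to final space is half the partial isometry, hence
   the doubling. *)
pose V := G * Q * P; pose W := V + V.
have Wp i : W * p i = w i.
  rewrite /W /V mulrDl -!mulrA (Pp (p i)) // Qpi !mulrA -kC -mulrA mulrDr GP add0r Gw.
  exact: kk.
have Wag i : adj W * g i = adj (w i).
  rewrite /W adjD /V !adjM Pa (adj_proj pQ) Ga.
  rewrite mulrDl -!mulrA (Gp (g i)) // Qgi (mulrA P) -kC -mulrA mulrDr Pg add0r Pwa.
  exact: kk.
have WP : W * P = W by rewrite /W /V mulrDl -!mulrA proj_idem.
have GW : G * W = W by rewrite /W /V mulrDr !mulrA proj_idem.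
exists W; split=> //.
- have : (adj W * W - P) * P = 0.
    apply: supP => _ [i _ <-]; rewrite mulrBl -mulrA Wp Pp // -(gwK i) mulrA Wag wp.
    by rewrite subrr.
  by rewrite mulrBl -mulrA WP (proj_idem pP) => /eqP; rewrite subr_eq0 => /eqP.
- have : (W * adj W - G) * G = 0.
    apply: supG => _ [i _ <-]; rewrite mulrBl -mulrA -/(g i) Wag Gp //.
    by rewrite -(pwa i) mulrA Wp subrr.
  rewrite mulrBl -mulrA (proj_idem pG) => /eqP; rewrite subr_eq0 => /eqP <-.
  by rewrite -{2}GW adjM Ga.
Qed.

End OrthogonalAddition.

(* Locally, y has a polar decomposition: on some projection p below its initial
   space, y p = w k' for a partial isometry w with initial projection p. *)
Definition local_polar (A : starRingType) := forall s t y v : A,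
  projection s -> projection t -> s * t = 0 -> t * y * s = y ->
  v * (adj y * y) <> 0 ->
  exists p w k k', [/\ projection p, p * s = p,
    p * (adj y * y) = (adj y * y) * p, v * p <> 0
    & [/\ adj w * w = p, w = y * k, p * k = k & y * p = w * k']].

(** * Global polar decomposition between orthogonal projections *)

Section OrthogonalPolar.
Context {A : starRingType}.
Hypothesis baerA : baer A.
Variable k : A.
Hypothesis halfk : half_element k.
Hypothesis polarA : local_polar A.

(** Local polar decompositions over a maximal orthogonal family of projections are glued by
    [orthogonal_addition]. The last conclusion says that [w] and [y] have the same left support. *)
Lemma orthogonal_polar (s t y : A) :
  projection s -> projection t -> s * t = 0 -> t * y * s = y ->
  (forall x, y * x = 0 -> s * x = 0) ->
  exists w, adj w * w = s /\ forall x, x * y = 0 <-> x * w = 0.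
Proof.
move=> ps pt st tys yinj.
(* An existential keeps z opaque, so that rewriting does not look inside it. *)
have [z zE] : exists z, z = adj y * y by exists (adj y * y).
have ys : y * s = y by rewrite -{1}tys -mulrA (proj_idem ps).
have ty : t * y = y by rewrite -{1}tys !mulrA (proj_idem pt).
have zadj : adj z = z by rewrite zE adjM adjK.
(* Commutation with [z] is what makes the partial isometries over orthogonal projections have
   orthogonal ranges ([gorth] below). *)
pose good p := [/\ projection p, p * s = p, p * z = z * p &
  exists w k k', [/\ adj w * w = p, w = y * k, p * k = k & y * p = w * k']].
pose orth (F : set A) := (forall p, F p -> good p) /\
  (forall p q, F p -> F q -> p <> q -> p * q = 0).
have [F [[Fgood Forth] Fmax]] : exists F, orth F /\ forall B, F `<` B -> ~ orth B.
  apply: Zorn_bigcup => C Corth Ctot; split.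
    by move=> p [X CX Xp]; exact: (Corth X CX).1.
  move=> p q [X CX Xp] [Y CY Yq] pq.
  have [XY|YX] := Ctot X Y CX CY.
    by apply: (Corth Y CY).2 => //; exact: XY.
  by apply: (Corth X CX).2 => //; exact: YX.
have [P supP] : exists P, is_sup F P.
  by apply: sup_exists => // e /Fgood [].
have [pP PF supPF] := supP.
have sP : s * P = P.
  have : (1 - s) * P = 0.
    apply: supPF => p /Fgood [pp psp _ _].
    by rewrite mulrBl mul1r (proj_leC pp ps psp) subrr.
  exact: compl_mul0.
have zP : z * P = P * z.
  have PzP : z * P = P * z * P.
    have : (1 - P) * z * P = 0.
      apply: supPF => p Fp; have [_ _ pz _] := Fgood p Fp.
      by rewrite -mulrA -pz mulrA mulrBl mul1r PF // subrr mul0r.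
    by rewrite !mulrBl mul1r => /eqP; rewrite subr_eq0 => /eqP.
  have := congr1 adj PzP; rewrite !adjM zadj (adj_proj pP) => ->.
  by rewrite mulrA.
(* Otherwise [y * (s - P)] is nonzero and its local polar decomposition supplies a new member
   orthogonal to [F], against maximality. *)
have Ps : P = s.
  apply: contrapT => Ps.
  have Psz : P * s = P := proj_leR pP ps sP.
  have psP : projection (s - P) := projB ps pP Psz.
  pose y1 := y * (s - P).
  have sPsP : (s - P) * (s - P) = s - P := proj_idem psP.
  have z1E : adj y1 * y1 = z * (s - P).
    have zs : z * s = z by rewrite zE -mulrA ys.
    have sz : s * z = z by rewrite -{1}zadj -{1}(adj_proj ps) -adjM zs.
    have zC : (s - P) * z = z * (s - P) by rewrite mulrBl mulrBr sz zs zP.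
    by rewrite /y1 adjM (adj_proj psP) mulrA -(mulrA _ (adj y)) -zE zC -mulrA sPsP.
  have [|||p [w [m [m' [pp ps1 pz1 p1 [wp wy pm ym]]]]]] :=
      polarA (s := s - P) (t := t) (y := y1) (v := 1) psP pt _ _ _.
  - have Pt : P * t = 0 by rewrite -Psz -mulrA st mulr0.
    by rewrite mulrBl st Pt subr0.
  - by rewrite /y1 !mulrA ty -mulrA sPsP.
  - rewrite mul1r => /(adj_mul_eq0 baerA); rewrite /y1 => /yinj.
    by rewrite mulrBr (proj_idem ps) sP => /eqP; rewrite subr_eq0 => /eqP /esym.
  have sPp : (s - P) * p = p := proj_leC pp psP ps1.
  have pP0 : p * P = 0 by rewrite -ps1 -mulrA mulrBl sP (proj_idem pP) subrr mulr0.
  have pz : p * z = z * p.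
    have zp : z * p = adj y1 * y1 * p by rewrite z1E -mulrA sPp.
    have z1a : adj (adj y1 * y1) = adj y1 * y1 by rewrite adjM adjK.
    by rewrite -[LHS]adjK adjM zadj (adj_proj pp) zp adjM z1a (adj_proj pp).
  have gp : good p.
    split=> //; first by rewrite -ps1 -mulrA mulrBl (proj_idem ps) Psz.
    exists w, m, m'; split=> //; last by rewrite -ym /y1 -mulrA sPp.
    by rewrite wy /y1 -mulrA -pm (mulrA (s - P)) sPp.
  have Fp q : F q -> q * p = 0.
    move=> Fq; have [pq _ _ _] := Fgood q Fq; apply: (proj_orthC pp pq).
    by rewrite -(PF q) // mulrA pP0 mul0r.
  have nFp : ~ F p.
    by move=> /Fp; rewrite (proj_idem pp) => p0; apply: p1; rewrite mul1r.
  apply: (Fmax (F `|` [set p])).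
    split; first by move=> q Fq; left.
    by move=> /(_ p (or_intror erefl)).
  split; first by move=> q [/Fgood//|->].
  move=> q r [Fq|->] [Fr|->] qr //; first exact: Forth.
    exact: Fp.
  by have [pr _ _ _] := Fgood r Fr; apply: (proj_orthC pr pp (Fp r Fr)).
have /choice[w wP] : forall i : {p | F p}, exists w, exists k' k'',
    [/\ adj w * w = sval i, w = y * k', sval i * k' = k' & y * sval i = w * k''].
  by move=> [p Fp]; have [_ _ _ h] := Fgood p Fp.
have pF (i : {p | F p}) : projection (sval i) by have [] := Fgood _ (svalP i).
have Fs (i : {p | F p}) : sval i * s = sval i by have [] := Fgood _ (svalP i).
have Fz (i : {p | F p}) : sval i * z = z * sval i by have [] := Fgood _ (svalP i).
have tw i : t * w i = w i by have [? [? [_ -> _ _]]] := wP i; rewrite mulrA ty.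
have ww (i : {p | F p}) : adj (w i) * w i = sval i by have [? [? []]] := wP i.
have rangeF : range (sval : {p | F p} -> A) = F.
  apply/seteqP; split=> [_ [i _ <-]|p Fp]; first exact: svalP.
  by exists (exist _ p Fp).
have neq (i j : {p | F p}) : i <> j -> sval i <> sval j.
  case: i j => [p Fp] [q Fq] ij /= pq; subst q; apply: ij.
  by congr exist; exact: Prop_irrelevance.
have porth (i j : {p | F p}) : i <> j -> sval i * sval j = 0.
  by move=> /neq; apply: Forth; exact: svalP.
have gorth (i j : {p | F p}) : i <> j -> adj (w i) * w j = 0.
  move=> ij; have [m [? [_ -> <- _]]] := wP i; have [n [? [_ -> <- _]]] := wP j.
  rewrite adjM adjM (adj_proj (pF i)) !mulrA -(mulrA _ (adj y)) -zE.
  by rewrite -(mulrA (adj m)) Fz -!mulrA (mulrA (sval i)) porth // mul0r !mulr0.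
have pw (i j : {p | F p}) : sval i * w j = 0.
  by rewrite -Fs -tw -!mulrA (mulrA s) st mul0r mulr0.
have [G supG] : exists G, is_sup (range (fun i => w i * adj (w i))) G.
  apply: sup_exists => // _ [i _ <-]; exact: piso_range (pF i) (ww i).
have [|W [WW WG Ww]] := @orthogonal_addition A baerA k halfk _ sval w P G
    pF ww porth gorth pw _ supG; first by rewrite rangeF.
rewrite Ps in WW; exists W; split=> // x.
have Ws : W * s = W by apply: piso_source WW.
split=> [xy|xW].
  rewrite -Ws -Ps mulrA; apply: supPF => p Fp.
  have := Ww (exist _ p Fp); rewrite -mulrA /= => ->.
  have [? [? [_ -> _ _]]] := wP (exist _ p Fp); by rewrite mulrA xy mul0r.
rewrite -ys -Ps mulrA; apply: supPF => p Fp.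
have [? [? [_ _ _ /= E]]] := wP (exist _ p Fp).
by rewrite -mulrA E mulrA -Ww mulrA xW !mul0r.
Qed.

End OrthogonalPolar.

(** * One-sided injectivity in finite Baer star rings *)

Section FiniteBaerStarRings.
Context {A : starRingType}.
Hypothesis baerA : baer A.
Variable k : A.
Hypothesis halfk : half_element k.
Hypothesis polarA : local_polar A.
Hypothesis finA : finite_algebra A.

(** Finiteness of 1 passes to [e]: the sum [w + (1 - e)] is an isometry, hence unitary. *)
Lemma finite_piso (e w : A) :
  projection e -> adj w * w = e -> e * w = w -> w * adj w = e.
Proof.
move=> pe we ew; have wK := piso_source baerA pe we.
have wae : adj w * e = adj w by rewrite -(adj_proj pe) -adjM ew.
have eaw : e * adj w = adj w by rewrite -{1}(adj_proj pe) -adjM wK.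
have [c cE] : exists c, c = 1 - e by exists (1 - e).
have pc : projection c by rewrite cE; exact: projC.
have ec : e + c = 1 by rewrite cE addrC subrK.
have wc : w * c = 0 by rewrite cE mulrBr mulr1 wK subrr.
have wac : adj w * c = 0 by rewrite cE mulrBr mulr1 wae subrr.
have cw : c * w = 0 by rewrite cE mulrBl mul1r ew subrr.
have cwa : c * adj w = 0 by rewrite cE mulrBl mul1r eaw subrr.
pose v := w + c.
have va : adj v = adj w + c by rewrite /v adjD (adj_proj pc).
have vv : adj v * v = 1.
  by rewrite va /v mulrDl !mulrDr (proj_idem pc) we wac cw addr0 add0r.
have vva : v * adj v = w * adj w + c.
  by rewrite va /v mulrDl !mulrDr (proj_idem pc) wc cwa addr0 add0r.
have v1 : v * adj v = 1.
  apply: finA.2.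
  - by apply: (@piso_range _ baerA 1 v) => //; exact: projection1.
  - by rewrite /proj_le mulr1.
  - by exists v; split=> //; rewrite /partial_isometry vv; exact: projection1.
by apply: (addIr c); rewrite -vva v1.
Qed.

(* c maps s injectively into s - h; if c were isometric, h would be a wandering
   projection of the shift c. *)
Definition shift (s h c : A) := [/\ projection s, projection h, h * s = h,
  (s - h) * c * s = c & forall x, c * x = 0 -> s * x = 0].

(* The compression of c to s - h, further cut down by the left support f of c h,
   stays injective: otherwise its kernel K and h would both be squeezed into f ~ h. *)
Lemma shift_step (s h c : A) : shift s h c ->
  exists w c', adj w * w = h /\ shift (s - h) (w * adj w) c'.
Proof.
move=> [ps ph hs Bcs cinj].
have sh := proj_leC ph ps hs.
have pB : projection (s - h) := projB ps ph hs.
have [B BE] : exists B, B = s - h by exists (s - h).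
rewrite -BE in pB Bcs *.
have hB : h * B = 0 by rewrite BE mulrBr hs (proj_idem ph) subrr.
have Bh : B * h = 0 := proj_orthC ph pB hB.
have Bs : B * s = B by rewrite BE mulrBl (proj_idem ps) hs.
have sB : s * B = B := proj_leC pB ps Bs.
have Bc : B * c = c by rewrite -{1}Bcs !mulrA (proj_idem pB).
have [y yE] : exists y, y = c * h by exists (c * h).
have By : B * y = y by rewrite yE mulrA Bc.
have yh : y * h = y by rewrite yE -mulrA (proj_idem ph).
have Byh : B * y * h = y by rewrite By.
have yinj x : y * x = 0 -> h * x = 0.
  by rewrite yE -mulrA => /cinj; rewrite mulrA sh.
have [w [ww wy]] := orthogonal_polar baerA halfk polarA ph pB hB Byh yinj.
have [f fE] : exists f, f = w * adj w by exists (w * adj w).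
have pf : projection f by rewrite fE; exact: piso_range ww.
have fw : f * w = w by rewrite fE; exact: piso_rangeK ww.
have wh : w * h = w := piso_source baerA ph ww.
have yf x : x * y = 0 -> x * f = 0.
  by move=> /wy xw; rewrite fE mulrA xw mul0r.
have fy : f * y = y.
  have : (1 - f) * y = 0 by apply/wy; rewrite mulrBl mul1r fw subrr.
  exact: compl_mul0.
have Bf : B * f = f.
  have : (1 - B) * f = 0 by apply: yf; rewrite mulrBl mul1r By subrr.
  exact: compl_mul0.
have fB := proj_leR pf pB Bf.
have hf : h * f = 0 by rewrite -Bf mulrA hB mul0r.
have [c' c'E] : exists c', c' = (B - f) * c * B by exists ((B - f) * c * B).
exists w, c'; split=> //; rewrite -fE.
(* [K] projects onto the kernel of [c'] inside [B]; injectivity of [c'] amounts to [K = 0]. *)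
have [K [pK KP]] := baerA [set x | x = c' \/ x = 1 - B].
have Kann : forall x, K * x = x -> c' * x = 0 /\ B * x = x.
  move=> x /KP H; split; first by apply: H; left.
  have := H (1 - B) (or_intror erefl).
  exact: compl_mul0.
have [c'K BK] := Kann K (proj_idem pK).
have KB := proj_leR pK pB BK.
suff K0 : K = 0.
  split=> //; first by rewrite c'E !mulrA (proj_idem (projB pB pf fB)) -!mulrA (proj_idem pB).
  move=> x c'x; suff : K * (B * x) = B * x by rewrite K0 mul0r.
  apply/KP => _ [->|->].
    by rewrite c'E -mulrA (mulrA B) (proj_idem pB) mulrA -c'E.
  by rewrite mulrA mulrBl mul1r (proj_idem pB) subrr mul0r.
have fcK : f * c * K = c * K.
  move: c'K; rewrite c'E -mulrA BK mulrBl Bc mulrBl => /eqP.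
  by rewrite subr_eq0 => /eqP.
have hK : h * K = 0 by rewrite -BK mulrA hB mul0r.
have Kh : K * h = 0 := proj_orthC ph pK hK.
have cKh : f * c * (K + h) = c * (K + h).
  by rewrite !mulrDr fcK -mulrA -yE fy.
have sK : s * K = K by rewrite -BK mulrA sB.
(* If K is orthogonal to f, then c maps K + h injectively into f, whence K + h ~ h' <= h. *)
case: (pselect (f * K = 0)) => [fK|/eqP fK].
  have Kf := proj_orthC pf pK fK.
  have pS : projection (K + h) := projD pK ph Kh.
  have [d dE] : exists d, d = f * c * (K + h) by exists (f * c * (K + h)).
  have [|||u [uu ud]] := orthogonal_polar baerA halfk polarA pS pf _ _ (y := d).
  - by rewrite mulrDl Kf hf addr0.
  - by rewrite dE -!mulrA (mulrA f f) (proj_idem pf) (proj_idem pS).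
  - move=> x; rewrite dE cKh -mulrA => /cinj.
    by rewrite mulrA mulrDr sh sK.
  have fu : f * u = u.
    have : (1 - f) * u = 0.
      by apply/ud; rewrite dE !mulrA mulrBl mul1r (proj_idem pf) subrr !mul0r.
    exact: compl_mul0.
  have mm : adj (adj w * u) * (adj w * u) = K + h.
    by rewrite adjM adjK mulrA -(mulrA (adj u)) -fE -mulrA fu.
  have hm : h * (adj w * u) = adj w * u.
    by rewrite mulrA -{1}(adj_proj ph) -adjM wh.
  have Sh : (K + h) * h = h by rewrite mulrDl Kh (proj_idem ph) add0r.
  (* By finiteness the range is all of [K + h]; as it also lies below [h], [K] vanishes. *)
  have mma : (adj w * u) * adj (adj w * u) = K + h.
    by apply: finite_piso => //; rewrite -hm mulrA Sh.
  have : h * (K + h) = K + h by rewrite -mma mulrA hm.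
  by rewrite mulrDr hK (proj_idem ph) add0r => /esym/eqP; rewrite -subr_eq0 addrK => /eqP.
have Ky : K * y <> 0.
  by move=> /yf /(proj_orthC pK pf) ?; apply/(elimN eqP fK).
(* With [K * y] as test element, [polarA] returns a [p] for which [K] does not annihilate
   [y * p]. *)
have Kyz : K * y * (adj y * y) <> 0.
  move=> Kyz; apply: Ky; apply: (mul_adj_eq0 baerA).
  have Kyya : K * y * adj y = 0.
    apply: (mul_adj_eq0 baerA).
    by rewrite !adjM adjK !mulrA -(mulrA (K * y)) Kyz !mul0r.
  by rewrite adjM mulrA Kyya mul0r.
(* Otherwise K meets the range q of y p for some window p. The part K' of K on which q is
   injective leaves room in B - K' for a copy of h1 = h - p ~ f - q, and c maps K' + h1
   injectively into f - q up to q; so K' + h1 ~ h2 <= h1. *)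
have [p [w1 [l [l' [pp ph' pz Kyp [w11 wl pl yp]]]]]] := polarA ph pB hB Byh Kyz.
have hp : h * p = p := proj_leC pp ph ph'.
have [q qE] : exists q, q = w1 * adj w1 by exists (w1 * adj w1).
have pq : projection q by rewrite qE; exact: piso_range w11.
have qy : q * y = y * p.
  have qyp : q * y * p = y * p.
    by rewrite -mulrA yp qE mulrA (piso_rangeK baerA pp w11).
  rewrite -qyp; apply/eqP; rewrite -subr_eq0 -{1}(mulr1 (q * y)) -mulrBr; apply/eqP.
  have la : adj l * p = adj l by rewrite -{1}(adj_proj pp) -adjM pl.
  have wap : adj w1 * y = adj w1 * y * p.
    by rewrite wl adjM -!mulrA (mulrA (adj y)) -pz (mulrA (adj l) p) la.
  by rewrite mulrBr mulr1 qE -!mulrA (mulrA (adj w1)) -wap subrr.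
(* [g] is a right inverse of [y] on the range [q] of [y * p]: [y * g = q]. *)
have [g gE] : exists g, g = l * adj w1 by exists (l * adj w1).
have pg : p * g = g by rewrite gE mulrA pl.
have qg : q = y * g by rewrite gE mulrA -wl qE.
have fq : f * q = q by rewrite qg mulrA fy.
have qf := proj_leR pq pf fq.
have Kyp' : K * (q * y) <> 0 by move=> E; apply: Kyp; rewrite -mulrA -qy.
have [K' [pK' qKK' K'P]] := right_support baerA (q * K).
have K'K : K' * K = K'.
  have : K' * (1 - K) = 0.
    by apply: K'P; rewrite mulrBr mulr1 -mulrA (proj_idem pK) subrr.
  by rewrite mulrBr mulr1 => /eqP; rewrite subr_eq0 => /eqP.
have KK' := proj_leC pK' pK K'K.
have K'0 : K' <> 0.
  move=> K'0; apply: Kyp'; rewrite mulrA (proj_orthC pq pK) ?mul0r //.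
  by rewrite -qKK' K'0 mulr0.
have qK' x : q * K' * x = 0 -> K' * x = 0.
  move=> qx; have /K'P : q * K * (K' * x) = 0 by rewrite mulrA -(mulrA q) KK'.
  by rewrite mulrA (proj_idem pK').
have BK' : B * K' = K' by rewrite -KK' mulrA BK.
have K'B := proj_leR pK' pB BK'.
have K'h : K' * h = 0 by rewrite -K'K -mulrA Kh mulr0.
have hK' := proj_orthC pK' ph K'h.
have ph1 : projection (h - p) := projB ph pp ph'.
have [h1 h1E] : exists h1, h1 = h - p by exists (h - p).
rewrite -h1E in ph1.
have hh1 : h * h1 = h1 by rewrite h1E mulrBr (proj_idem ph) hp.
have h1h := proj_leR ph1 ph hh1.
have ph10 : p * h1 = 0 by rewrite h1E mulrBr ph' (proj_idem pp) subrr.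
have qyh1 : q * y * h1 = 0 by rewrite qy -mulrA ph10 mulr0.
have pt : projection (B - K') := projB pB pK' K'B.
have [t tE] : exists t, t = B - K' by exists (B - K').
rewrite -tE in pt.
have h1t : h1 * t = 0.
  by rewrite -h1h -mulrA tE mulrBr hB hK' subrr mulr0.
have K't : K' * t = 0 by rewrite tE mulrBr K'B (proj_idem pK') subrr.
(* [u1] copies [h1] into [t]. For injectivity: if [t * y * h1] kills [x], then [y * h1 * x] lies in
   [K'], where [q] is injective, while [q * y * h1 = 0]. *)
have [|x|u1 [uu1 ud1]] :=
    orthogonal_polar baerA halfk polarA ph1 pt h1t _ _ (y := t * y * h1).
- by rewrite -!mulrA (proj_idem ph1) !mulrA (proj_idem pt).
- rewrite -!mulrA => tx; have ayx : y * (h1 * x) = K' * (y * (h1 * x)).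
    by move: tx; rewrite tE mulrBl (mulrA B) By => /eqP; rewrite subr_eq0 => /eqP.
  have : y * (h1 * x) = 0.
    by rewrite ayx; apply: qK'; rewrite -mulrA -ayx !mulrA qyh1 mul0r.
  by move=> /yinj; rewrite mulrA hh1.
have tu1 : t * u1 = u1.
  have : (1 - t) * u1 = 0.
    by apply/ud1; rewrite !mulrA mulrBl mul1r (proj_idem pt) subrr !mul0r.
  exact: compl_mul0.
have pf1 : projection (f - q) := projB pf pq qf.
have [f1 f1E] : exists f1, f1 = f - q by exists (f - q).
rewrite -f1E in pf1.
have ff1 : f * f1 = f1 by rewrite f1E mulrBr (proj_idem pf) fq.
have f1f := proj_leR pf1 pf ff1.
have f1q : f1 * q = 0 by rewrite f1E mulrBl fq (proj_idem pq) subrr.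
have h1f1 : h1 * f1 = 0 by rewrite -h1h -ff1 -!mulrA (mulrA h) hf mul0r mulr0.
have f1yh1 : f1 * y * h1 = y * h1.
  by rewrite f1E mulrBl fy mulrBl qyh1 subr0.
have [|x|u2 [uu2 ud2]] :=
    orthogonal_polar baerA halfk polarA ph1 pf1 h1f1 _ _ (y := y * h1).
- by rewrite -mulrA -(mulrA y) (proj_idem ph1) mulrA f1yh1.
- by rewrite -mulrA => /yinj; rewrite mulrA hh1.
have f1u2 : f1 * u2 = u2.
  have : (1 - f1) * u2 = 0.
    by apply/ud2; rewrite mulrBl mul1r mulrA f1yh1 subrr.
  exact: compl_mul0.
have u2f1 : adj u2 * f1 = adj u2 by rewrite -{1}(adj_proj pf1) -adjM f1u2.
have qu2 : q * u2 = 0 by apply/ud2; rewrite mulrA qyh1.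
have u2q : adj u2 * q = 0 by rewrite -(adj_proj pq) -adjM qu2 adj0.
have u22 : u2 * adj u2 = f1.
  (* [r] kills [y * h1] and also [y * p = q * y], hence [y] and its left support [f]; so [u2] has
     full range [f1]. *)
  have [r rE] : exists r, r = f1 - u2 * adj u2 by exists (f1 - u2 * adj u2).
  have rq : r * q = 0 by rewrite rE mulrBl f1q -mulrA u2q mulr0 subrr.
  have ryh1 : r * (y * h1) = 0.
    by apply/ud2; rewrite rE mulrBl f1u2 (piso_rangeK baerA ph1 uu2) subrr.
  have : r * f1 = 0.
    rewrite -ff1 mulrA yf ?mul0r // -yh -(subrK p h) -h1E !mulrDr.
    by rewrite ryh1 -qy mulrA rq mul0r addr0.
  rewrite rE mulrBl (proj_idem pf1) -mulrA u2f1 => /eqP.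
  by rewrite subr_eq0 => /eqP ->.
have pS : projection (K' + h1).
  by apply: projD => //; rewrite -hh1 mulrA K'h mul0r.
have [S SE] : exists S, S = K' + h1 by exists (K' + h1).
rewrite -SE in pS.
have KhS : (K + h) * S = S.
  by rewrite SE mulrDl !mulrDr KK' hK' hh1 -{1}hh1 mulrA Kh mul0r addr0 add0r.
have sS : s * S = S by rewrite -KhS mulrA mulrDr sK sh.
have pS0 : p * S = 0.
  by rewrite SE mulrDr ph10 addr0 -ph' -mulrA hK' mulr0.
have Sh1 : S * h1 = h1.
  by rewrite SE mulrDl (proj_idem ph1) -{1}hh1 mulrA K'h mul0r add0r.
(* The factor [u1 * adj u2] moves the range from [f1] into [t], which is orthogonal to [S], as
   [orthogonal_polar] requires. *)
have [m mE] : exists m, m = u1 * adj u2 * f1 * c * S by exists (u1 * adj u2 * f1 * c * S).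
have [||x|u [uu ud]] := orthogonal_polar baerA halfk polarA pS pt _ _ (y := m).
- by rewrite SE mulrDl K't h1t addr0.
- by rewrite mE -!mulrA (proj_idem pS) mulrA tu1.
- rewrite mE => mx.
  have f1cx : f1 * c * S * x = 0.
    have := congr1 (fun y => u2 * adj u1 * y) mx; rewrite mulr0 !mulrA.
    rewrite -(mulrA u2 (adj u1)) uu1 (piso_source baerA ph1 uu2) u22.
    by rewrite (proj_idem pf1).
  have fca : f * c * (S * x) = c * (S * x).
    by rewrite -KhS !mulrA cKh.
  have cqa : c * (S * x) = q * c * (S * x).
    move: f1cx; rewrite f1E -!mulrA mulrBl => /eqP.
    by rewrite subr_eq0 (mulrA f) fca => /eqP.
  have : s * (S * x - h * g * c * (S * x)) = 0.
    by apply: cinj; rewrite mulrBr cqa qg yE !mulrA subrr.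
  have hg : h * g = g by rewrite -pg mulrA hp.
  rewrite mulrBr (mulrA s S) sS -!mulrA (mulrA s h) sh (mulrA h g) hg => /eqP.
  rewrite subr_eq0 => /eqP Sx.
  by have := congr1 (fun a => a * x) pS0; rewrite -mulrA Sx !mulrA pg mul0r.
have ru : u1 * adj u1 * u = u.
  have : (1 - u1 * adj u1) * u = 0.
    apply/ud; rewrite mE !mulrA mulrBl mul1r.
    by rewrite (piso_rangeK baerA ph1 uu1) subrr !mul0r.
  exact: compl_mul0.
have nn : adj (adj u1 * u) * (adj u1 * u) = S.
  by rewrite adjM adjK mulrA -(mulrA (adj u)) -mulrA ru.
have hn : h1 * (adj u1 * u) = adj u1 * u.
  by rewrite mulrA -{1}(adj_proj ph1) -adjM (piso_source baerA ph1 uu1).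
have nna : (adj u1 * u) * adj (adj u1 * u) = S.
  by apply: finite_piso => //; rewrite -hn mulrA Sh1.
case: K'0; have : h1 * S = S by rewrite -nna mulrA hn.
rewrite SE mulrDr (proj_idem ph1) -{1}h1h -mulrA hK' mulr0 add0r.
by move=> /esym/eqP; rewrite -subr_eq0 addrK => /eqP.
Qed.

(* The successive ranges e n of the wandering projection would be orthogonal and
   equivalent; then the sum of the e (2 n) is equivalent, through that of the
   e (2 n + 1), to the sum of the e (2 n + 2), a proper subprojection of itself. *)
Lemma shift_trivial (s h c : A) : shift s h c -> h = 0.
Proof.
move=> shc.
pose T := {x : A * A * A | shift x.1.1 x.1.2 x.2}.
have /choice[nxt nxtP] : forall x : T, exists yw : T * A,
    [/\ (sval yw.1).1.1 = (sval x).1.1 - (sval x).1.2,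
        adj yw.2 * yw.2 = (sval x).1.2 & yw.2 * adj yw.2 = (sval yw.1).1.2].
  move=> [[[s' h'] d] /= /shift_step[w [d' [ww sh']]]].
  by exists (exist _ (s' - h', w * adj w, d') sh', w).
pose x n := iter n (fun x => (nxt x).1) (exist _ (s, h, c) shc : T).
pose S n := (sval (x n)).1.1; pose e n := (sval (x n)).1.2.
pose w n := (nxt (x n)).2.
have pS n : projection (S n) by have [] := svalP (x n).
have pe n : projection (e n) by have [] := svalP (x n).
have eS n : e n * S n = e n by have [] := svalP (x n).
have SS n : S n.+1 = S n - e n by have [] := nxtP (x n).
have ww n : adj (w n) * w n = e n by have [] := nxtP (x n).
have wwa n : w n * adj (w n) = e n.+1 by have [] := nxtP (x n).
have Se n : S n * e n = e n := proj_leC (pe n) (pS n) (eS n).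
have SSm n m : S (n + m)%N * S n = S (n + m)%N.
  elim: m => [|m IH]; first by rewrite addn0 (proj_idem (pS n)).
  rewrite addnS SS mulrBl IH; congr (_ - _).
  by rewrite -eS -mulrA IH.
have eSm n m : (n <= m)%N -> e m * S n = e m.
  by move=> /subnKC <-; rewrite -eS -mulrA SSm.
have eom n m : (n < m)%N -> e m * e n = 0.
  move=> nm; rewrite -(eSm _ _ nm) SS -mulrA mulrBl Se (proj_idem (pe n)).
  by rewrite subrr mulr0.
have eo n m : n <> m -> e n * e m = 0.
  move=> /eqP; rewrite neq_ltn => /orP[] /eom //.
  exact: proj_orthC.
have weK n : w n * e n = w n := piso_source baerA (pe n) (ww n).
have ewK n : e n.+1 * w n = w n by rewrite -wwa (piso_rangeK baerA (pe n) (ww n)).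
have waw n m : n <> m -> adj (w n) * w m = 0.
  move=> nm; rewrite -(ewK n) -(ewK m) adjM (adj_proj (pe _)) -mulrA (mulrA (e _)).
  by rewrite eo ?mul0r ?mulr0 // => -[].
have sup_e (f : nat -> nat) : exists E, is_sup (range (e \o f)) E.
  by apply: sup_exists => // _ [n _ <-]; exact: pe.
have ew n m : n <> m.+1 -> e n * w m = 0.
  by move=> nm; rewrite -ewK mulrA eo // mul0r.
have [E0 supE0] := sup_e (fun n => n.*2).
have [E1 supE1] := sup_e (fun n => n.*2.+1).
have [E2 supE2] := sup_e (fun n => n.*2.+2).
have dinj n m : n <> m -> n.*2 <> m.*2.
  by move=> nm /(congr1 half); rewrite !doubleK.
have dodd n m : n.*2 <> m.*2.+1.
  by move=> /(congr1 odd); rewrite /= !odd_double.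
(* [orthogonal_addition] needs every initial projection orthogonal to every range, so the shift of
   the even indices is factored through the odd ones. *)
have [||||||W1 [W1W W1a _]] := orthogonal_addition baerA halfk
    (p := fun n => e n.*2) (w := fun n => w n.*2) (P := E0) (G := E1) _ _ _ _ _ supE0.
- by move=> n; exact: pe.
- by move=> n; exact: ww.
- by move=> n m /dinj /eo.
- by move=> n m /dinj /waw.
- by move=> n m; apply: ew; exact: dodd.
- by under eq_fun do rewrite wwa.
have [||||||W2 [W2W W2a _]] := orthogonal_addition baerA halfk
    (p := fun n => e n.*2.+1) (w := fun n => w n.*2.+1) (P := E1) (G := E2) _ _ _ _ _ supE1.
- by move=> n; exact: pe.
- by move=> n; exact: ww.
- by move=> n m /dinj nm; apply: eo => -[].
- by move=> n m /dinj nm; apply: waw => -[].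
- by move=> n m; apply: ew => -[]; exact: dodd.
- by under eq_fun do rewrite wwa.
have [pE0 E0e supE0'] := supE0; have [pE1 _ _] := supE1; have [pE2 _ supE2'] := supE2.
have E02 : E0 * E2 = E2.
  have : (1 - E0) * E2 = 0.
    apply: supE2' => _ [n _ <-]; rewrite mulrBl mul1r E0e ?subrr //.
    by exists n.+1.
  exact: compl_mul0.
have E2W2 : E2 * W2 = W2 by rewrite -W2a (piso_rangeK baerA pE1 W2W).
have W2E1 : W2 * E1 = W2 := piso_source baerA pE1 W2W.
have W1E0 : W1 * E0 = W1 := piso_source baerA pE0 W1W.
have E1W1 : E1 * W1 = W1 by rewrite -W1a (piso_rangeK baerA pE0 W1W).
have WW : adj (W2 * W1) * (W2 * W1) = E0.
  by rewrite adjM mulrA -(mulrA (adj W1)) W2W -mulrA E1W1.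
have WWa : (W2 * W1) * adj (W2 * W1) = E2.
  by rewrite adjM mulrA -(mulrA W2) W1a W2E1.
have E20 : E2 = E0.
  by rewrite -WWa; apply: finite_piso => //; rewrite -E2W2 !mulrA E02.
have he0 : h = e 0%N by [].
have : e 0%N * E2 = 0 by apply: supE2' => _ [n _ <-]; exact: eo.
rewrite E20 => /(proj_orthC (pe 0%N) pE0); rewrite E0e //.
by exists 0%N.
Qed.

(** If [f] is the left support of [c], then [1 - f] is the wandering projection of a shift, so
    [shift_trivial] makes it vanish. *)
Lemma inj_adj_inj (c : A) :
  (forall x, c * x = 0 -> x = 0) -> forall x, x * c = 0 -> x = 0.
Proof.
move=> cinj; have [f [pf fc cf]] := left_support baerA c.
suff f1 : 1 - f = 0.
  move: f1 => /eqP; rewrite subr_eq0 => /eqP f1 x /cf.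
  by rewrite -f1 mulr1.
apply: (@shift_trivial 1 (1 - f) c); split.
- exact: projection1.
- exact: projC.
- by rewrite mulr1.
- by rewrite mulr1 opprB addrC subrK.
- by move=> x /cinj ->; rewrite mulr0.
Qed.

Lemma adj_inj_inj (c : A) :
  (forall x, x * c = 0 -> x = 0) -> forall x, c * x = 0 -> x = 0.
Proof.
move=> cinj x cx; apply: adj_eq0.
apply: (@inj_adj_inj (adj c)); last by rewrite -adjM cx adj0.
by move=> y cy; apply: adj_eq0; apply: cinj; rewrite -(adjK c) -adjM cy adj0.
Qed.

(* The projection p is the least one whose right ideal J = pA satisfies
   a x \in J <-> x \in J. Hence (1 - p) a (1 - p) is injective, and minimality
   makes (a - 1) p left injective. *)
Lemma finite_almost_star_clean : almost_star_clean A.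
Proof.
move=> a.
pose stable q := projection q /\ forall x, q * x = x <-> q * (a * x) = a * x.
(* Annihilating all [1 - q] means lying in every ideal [qA], so [p] is the infimum of the stable
   projections; [pa] shows that it is itself stable. *)
have [p [pp pP]] := baerA [set x | exists2 q, stable q & x = 1 - q].
have pE x : p * x = x <-> forall q, stable q -> q * x = x.
  rewrite -pP; split=> [H q sq|H _ [q sq ->]].
    have := H (1 - q); rewrite mulrBl mul1r => /(_ _)/eqP.
    by rewrite subr_eq0 eq_sym => H1; apply/eqP/H1; exists q.
  by rewrite mulrBl mul1r H // subrr.
have pa x : p * x = x <-> p * (a * x) = a * x.
  by rewrite !pE; split=> H q sq; have [_ qP] := sq; apply/(qP x); exact: H.
have pap : p * (a * p) = a * p by apply/(pa p); rewrite (proj_idem pp).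
have left_inj x : x * (a - 1) * p = 0 -> x * p = 0.
  (* The ideal of [r] is the part of [pA] annihilated by [x]. Since [x * a = x] on it up to right
     multiples, [r] is stable, and minimality gives [p <= r]. *)
  move=> xap; have [r [pr rP]] := baerA [set y | y = x \/ y = 1 - p].
  have rE y : r * y = y <-> x * y = 0 /\ p * y = y.
    rewrite -rP; split=> [H|[xy py] _ [->//|->]].
      split; first by apply: H; left.
      have := H (1 - p) (or_intror erefl).
      by rewrite mulrBl mul1r => /eqP; rewrite subr_eq0 eq_sym => /eqP.
    by rewrite mulrBl mul1r py subrr.
  have xay y : p * y = y -> x * (a * y) = x * y.
    move=> py; have := congr1 (fun z => z * y) xap.
    rewrite mul0r -mulrA py mulrBr mulr1 mulrBl -mulrA => /eqP.
    by rewrite subr_eq0 => /eqP.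
  have sr : stable r.
    split=> // y; rewrite !rE; split=> [[xy py]|[xy apy]].
      by rewrite xay // xy; split=> //; apply/(pa y).
    by have py := (pa y).2 apy; rewrite -(xay y py).
  have : r * p = p by apply: (pE p).1; rewrite ?(proj_idem pp).
  by move=> /rE [].
have pcp := proj_idem pp.
exists (a - p), p; split=> //; last by rewrite subrK.
have right_inj x : (a - p) * x = 0 -> x = 0.
  move=> apx.
  have axpx : a * x = p * x.
    by move: apx; rewrite mulrBl => /eqP; rewrite subr_eq0 => /eqP.
  have px : p * x = x by apply/(pa x); rewrite axpx mulrA pcp.
  (* [c] is [a - 1] on [p] and the identity on [1 - p]: it is left injective by [left_inj] and kills
     [x]. *)
  pose c := (a - 1) * p + (1 - p).
  apply: (@adj_inj_inj c).
    move=> y; rewrite /c mulrDr mulrA => yc.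
    have yap : y * (a - 1) * p = 0.
      have := congr1 (fun z => z * p) yc.
      rewrite mul0r mulrDl -(mulrA y (1 - p)) mulrBl mul1r pcp subrr mulr0 addr0.
      by rewrite -!mulrA pcp.
    by move: yc; rewrite yap add0r mulrBr mulr1 (left_inj y yap) subr0.
  by rewrite /c mulrDl -mulrA px mulrBl mul1r axpx mulrBl mul1r px subrr addr0.
split=> //; exact: inj_adj_inj.
Qed.

End FiniteBaerStarRings.

(** * Inverses and square roots near the identity *)

Section HalfContraction.
Context {R : realType} {V : completeNormedModType R[i]}.

Lemma halving_small (r e : R[i]) : 0 <= r -> 0 < e ->
  exists N, forall n, (N <= n)%N -> 2^-1 ^+ n * r < e.
Proof.
move=> r0 e0.
have re : r / e \is Num.real by rewrite realM ?realV ?ger0_real ?gtr0_real // ltW.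
pose N := Num.Def.archi_bound (complex.Re (r / e)); exists N => n Nn.
rewrite exprVn mulrC ltr_pdivrMr ?exprn_gt0 // mulrC -ltr_pdivrMr //.
rewrite -(RRe_real re) -natrX -(rmorph_nat (real_complex R)) ltcR natrX.
exact: upper_nthrootP.
Qed.

(** Banach iteration from 0, restricted to a ball because the quadratic map of [sqrt_near1]
    contracts only there. *)
Lemma half_contraction_fixpoint (F : V -> V) (r : R[i]) : 0 <= r ->
  (forall x, `|x| <= r -> `|F x| <= r) ->
  (forall x y, `|x| <= r -> `|y| <= r -> `|F x - F y| <= 2^-1 * `|x - y|) ->
  exists x, `|x| <= r /\ F x = x.
Proof.
move=> r0 Fr Fc; pose u n := iter n F 0.
have ur n : `|u n| <= r by elim: n => [|n IH]; rewrite ?normr0 //=; exact: Fr.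
(* The orbit starts at 0 and stays in the ball, so [r] bounds the case [n = 0] for all [m] and no
   geometric series is summed. *)
have udist n m : `|u n - u (n + m)%N| <= 2^-1 ^+ n * r.
  elim: n => [|n IH]; first by rewrite add0n expr0 mul1r sub0r normrN.
  rewrite addSn /= exprS -mulrA; apply: le_trans (Fc _ _ (ur _) (ur _)) _.
  by rewrite ler_wpM2l // invr_ge0.
have : cvg (u @ \oo).
  apply/cauchy_cvgP/cauchy_exP => e e0.
  have [N small] := halving_small r0 e0; exists (u N).
  exists N => // n /= Nn; rewrite -ball_normE /=.
  by rewrite -(subnKC Nn); apply: le_lt_trans (udist _ _) (small N _).
move=> /cvg_ex[l ul].
have lu e : 0 < e -> exists n, `|l - u n| < e /\ `|l - u n.+1| < e.
  move=> e0; have := (@cvgrPdist_lt _ _ _ _ _ u l).1 ul e e0.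
  by move=> [N _ H]; exists N; split; apply: H => //=.
have lr : `|l| <= r.
  rewrite real_leNgt ?normr_real ?ger0_real //; apply/negP => rl.
  have [n [+ _]] := lu _ (etrans (subr_gt0 _ _) rl : 0 < `|l| - r).
  rewrite ltrBrDr => ln; suff : `|l| < `|l| by rewrite ltxx.
  apply: le_lt_trans ln; rewrite -{1}(subrK (u n) l).
  by apply: le_trans (ler_normD _ _) _; rewrite lerD2l.
exists l; split=> //; apply/eqP; rewrite -subr_eq0 -normr_eq0; apply/eqP.
have := normr_ge0 (F l - l); rewrite le_eqVlt => /orP[/eqP/esym //|d0].
have [n [l1 l2]] := lu _ (divr_gt0 d0 (ltr0n _ 2)).
suff : `|F l - l| < `|F l - l| by rewrite ltxx.
rewrite {1}(_ : F l - l = (F l - F (u n)) - (l - u n.+1)); last first.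
  by rewrite /= opprB addrA subrK.
apply: le_lt_trans (ler_normB _ _) _; rewrite [ltRHS]splitr.
apply: ltrD => //; apply: le_lt_trans (Fc _ _ lr (ur n)) _.
apply: le_lt_trans l1; rewrite -[leRHS]mul1r ler_wpM2r //.
by rewrite invf_le1 ?ltr0n // ler1n.
Qed.

End HalfContraction.

HB.instance Definition _ (R : realType) (A : cstarAlgType R) :=
  GRing.Lmodule.copy (cstar_ring A) A.
HB.instance Definition _ (R : realType) (A : cstarAlgType R) :=
  Num.NormedZmodule.copy (cstar_ring A) A.

(** * Norm estimates, inverses and square roots in a C*-algebra *)

Section CStarBasics.
Context {R : realType} {A : cstarAlgType R}.
Local Notation T := (cstar_ring A).
Implicit Types (x y z p e s t u v w : T) (c : R[i]).

Lemma cstar_scalerAl c x y : c *: (x * y) = (c *: x) * y.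
Proof. exact: (@cscaleAl R A). Qed.

Lemma cstar_scalerAr c x y : c *: (x * y) = x * (c *: y).
Proof. exact: (@cscaleAr R A). Qed.

Lemma adjZ c x : adj (c *: x) = Num.conj c *: adj x.
Proof. exact: (@cadjZ R A). Qed.

Lemma normrZc c x : `|c *: x| = `|c| * `|x|.
Proof. exact: (@normrZ _ A). Qed.

Lemma norm_mul_le x y : `|x * y| <= `|x| * `|y|.
Proof. exact: (@cnormM R A). Qed.

Lemma norm_adj_mul x : `|adj x * x| = `|x| ^+ 2.
Proof. exact: (@cstar_norm R A). Qed.

Lemma norm_adj x : `|adj x| = `|x|.
Proof.
suff H y : `|y| <= `|adj y| by apply/le_anti; rewrite H -{2}(adjK x) H.
have := normr_ge0 y; rewrite le_eqVlt => /orP[/eqP <-|y0]; first exact: normr_ge0.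
by rewrite -(ler_pM2r y0) -expr2 -norm_adj_mul norm_mul_le.
Qed.

Lemma cstar_mul_eq0 x : adj x * x = 0 -> x = 0.
Proof.
move=> xx; apply/eqP; rewrite -normr_eq0 -sqrf_eq0 -norm_adj_mul xx.
by rewrite normr0.
Qed.

Lemma norm_proj_le1 e : projection e -> `|e| <= 1.
Proof.
move=> [ea ee]; have [e0|e0] := eqVneq `|e| 0; first by rewrite e0 ler01.
have := norm_adj_mul e; rewrite ea ee expr2 -{1}(mulr1 `|e|) => /(mulfI e0) <-.
exact: lexx.
Qed.

Lemma norm_isometry_le1 u : adj u * u = 1 -> `|u| <= 1.
Proof.
move=> uu; have := norm_proj_le1 (@projection1 T); rewrite -uu norm_adj_mul.
by rewrite expr_le1 // normr_ge0.
Qed.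

Lemma half_inv_ge0 : 0 <= 2^-1 :> R[i]. Proof. by rewrite invr_ge0. Qed.

Lemma half1 : 2^-1 + 2^-1 = 1 :> R[i].
Proof. by rewrite [RHS]splitr mul1r. Qed.

Lemma conj_half : Num.conj (2^-1 : R[i]) = 2^-1.
Proof. by apply: conj_Creal; rewrite realV realn. Qed.

(** The right and left inverses are fixed points of [1 + t * x] and [1 + x * t] on the ball of
    radius 2, which these maps preserve. *)
Lemma inverse_near1 t : `|t| <= 2^-1 ->
  exists k : T, k * (1 - t) = 1 /\ (1 - t) * k = 1.
Proof.
move=> t2.
have n1 : `|1 : T| <= 1 := norm_proj_le1 projection1.
have b2 x : `|x| <= 2 -> 2^-1 * `|x| <= 1.
  by move=> x2; rewrite mulrC ler_pdivrMr ?mul1r ?ltr0n.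
have [k [_ kE]] : exists x : T, `|x| <= 2 /\ 1 + t * x = x.
  have Fr x : `|x| <= 2 -> `|1 + t * x| <= 2.
    move=> x2; apply: le_trans (ler_normD _ _) _; rewrite -[leRHS]natr1.
    apply: lerD => //.
    apply: le_trans (norm_mul_le _ _) _; apply: le_trans (b2 _ x2).
    by rewrite ler_wpM2r.
  have Fc x y : `|x| <= 2 -> `|y| <= 2 ->
      `|(1 + t * x) - (1 + t * y)| <= 2^-1 * `|x - y|.
    move=> _ _; rewrite [1 + t * x]addrC addrKA -mulrBr.
    by apply: le_trans (norm_mul_le _ _) _; rewrite ler_wpM2r.
  exact: (half_contraction_fixpoint (V := A) (ler0n _ 2) Fr Fc).
have [l [_ lE]] : exists x : T, `|x| <= 2 /\ 1 + x * t = x.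
  have Fr x : `|x| <= 2 -> `|1 + x * t| <= 2.
    move=> x2; apply: le_trans (ler_normD _ _) _; rewrite -[leRHS]natr1.
    apply: lerD => //.
    apply: le_trans (norm_mul_le _ _) _; apply: le_trans (b2 _ x2).
    by rewrite mulrC ler_wpM2r.
  have Fc x y : `|x| <= 2 -> `|y| <= 2 ->
      `|(1 + x * t) - (1 + y * t)| <= 2^-1 * `|x - y|.
    move=> _ _; rewrite [1 + x * t]addrC addrKA -mulrBl.
    by apply: le_trans (norm_mul_le _ _) _; rewrite mulrC ler_wpM2r.
  exact: (half_contraction_fixpoint (V := A) (ler0n _ 2) Fr Fc).
have k1 : (1 - t) * k = 1 by rewrite mulrBl mul1r -{1}kE addrK.
have l1 : l * (1 - t) = 1 by rewrite mulrBr mulr1 -{1}lE addrK.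
have kl : k = l by rewrite -[LHS]mul1r -l1 -mulrA k1 mulr1.
by exists k; rewrite {1}kl.
Qed.

(** The equation [(1 - s)^2 = 1 - t] reads [s = (t + s^2) / 2]. Uniqueness of the fixed point in the
    ball gives self-adjointness and the commutation property. *)
Lemma sqrt_near1 t : adj t = t -> `|t| <= 2^-1 ->
  exists s, [/\ adj s = s, `|s| <= 2^-1, (1 - s) * (1 - s) = 1 - t
    & forall p, projection p -> p * t = t * p -> p * s = s * p].
Proof.
move=> ta t2.
pose F x : T := 2^-1 *: (t + x * x).
have h0 := half_inv_ge0.
have nh : `|2^-1 : R[i]| = 2^-1 by rewrite ger0_norm.
have Fr x : `|x| <= 2^-1 -> `|F x| <= 2^-1.
  move=> x2; rewrite normrZc nh -[leRHS]mulr1 ler_wpM2l //.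
  rewrite [leRHS]splitr; apply: le_trans (ler_normD _ _) _.
  rewrite mul1r; apply: lerD => //; apply: le_trans (norm_mul_le _ _) _.
  apply: (le_trans _ x2); rewrite -[leRHS]mul1r ler_wpM2r //.
  by apply: le_trans x2 _; rewrite invf_le1 ?ltr0n // ler1n.
have Fc x y : `|x| <= 2^-1 -> `|y| <= 2^-1 -> `|F x - F y| <= 2^-1 * `|x - y|.
  move=> x2 y2; rewrite -scalerBr normrZc nh ler_wpM2l //.
  rewrite [X in `|X|](_ : _ = x * (x - y) + (x - y) * y); last first.
    by rewrite mulrBr mulrBl addrA subrK opprD addrACA subrr add0r.
  apply: le_trans (ler_normD _ _) _; rewrite -[leRHS]mul1r.
  rewrite -half1 [leRHS]mulrDl; apply: lerD.
    by apply: le_trans (norm_mul_le _ _) _; rewrite ler_wpM2r.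
  by apply: le_trans (norm_mul_le _ _) _; rewrite mulrC ler_wpM2r.
have uniq x y : `|x| <= 2^-1 -> `|y| <= 2^-1 -> F x = x -> F y = y -> x = y.
  move=> x2 y2 Fx Fy; have := Fc x y x2 y2; rewrite Fx Fy => H.
  apply/eqP; rewrite -subr_eq0 -normr_eq0; apply/negPn/negP => n0.
  have xy0 : 0 < `|x - y| by rewrite lt_def n0 normr_ge0.
  move: H; rewrite -[leLHS]mul1r ler_pM2r // => H.
  have : (1 : R[i]) < 1 by apply: le_lt_trans H _; rewrite invf_lt1 ?ltr0n // ltr1n.
  by rewrite ltxx.
have [s [s2 sE]] : exists s : T, `|s| <= 2^-1 /\ F s = s.
  exact: (half_contraction_fixpoint (V := A) h0 Fr Fc).
exists s; split=> //.
- apply: uniq => //; first by rewrite norm_adj.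
  by rewrite -[in RHS]sE /F adjZ adjD adjM ta conj_half.
- rewrite mulrBl mul1r mulrBr mulr1 opprB addrA addrAC -(addrA 1) -opprD.
  have -> : s + s = t + s * s.
    by rewrite -[in LHS]sE /F -scalerDl half1 scale1r.
  by rewrite opprD addrA subrK.
- move=> p [pa pp] pt.
  (* Conjugation by the symmetry [2p - 1] fixes [t], hence fixes [s]. *)
  have [u uE] : exists u, u = p + p - 1 by exists (p + p - 1).
  have uu : u * u = 1.
    rewrite {1}uE mulrBl mul1r mulrDl uE mulrBr mulr1 mulrDr pp addrK.
    by rewrite opprB addrA addrAC subrr add0r.
  have ua : adj u = u by rewrite uE adjB adjD pa adj1.
  have u1 : `|u| <= 1 by apply: norm_isometry_le1; rewrite ua.
  have ut : u * t = t * u by rewrite uE mulrBl mulrBr mulrDl mulrDr pt mul1r mulr1.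
  have usu : u * s * u = s.
    apply: uniq => //.
      apply: le_trans (norm_mul_le _ _) _; apply: le_trans s2.
      rewrite -[leRHS]mulr1; apply: ler_pM => //.
      apply: le_trans (norm_mul_le _ _) _.
      by rewrite -[leRHS]mul1r ler_wpM2r.
    rewrite -[in RHS]sE /F -cstar_scalerAr -cstar_scalerAl mulrDr mulrDl.
    by rewrite ut -(mulrA t) uu mulr1 !mulrA -(mulrA (u * s)) uu mulr1.
  have : u * s = s * u by rewrite -{2}usu -!mulrA uu mulr1.
  rewrite uE mulrBl mulrBr mulrDl mulrDr mul1r mulr1 => /addIr E.
  have E2 := congr1 (fun x => 2^-1 *: x) E.
  by move: E2; rewrite !scalerDr -!scalerDl half1 !scale1r.
Qed.

End CStarBasics.

(** * Spectral approximation in maximal commutative subalgebras *)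

Section Windows.
Context {R : realType} {A : cstarAlgType R}.
Local Notation T := (cstar_ring A).
Implicit Types (x y z p e s t u v w : T) (c : R[i]) (M S : set T).

(** Linear structure is left out to keep the Zorn argument light; a maximal such set is a subalgebra
    automatically. *)
Definition commuting_star_set S :=
  (forall x y, S x -> S y -> x * y = y * x) /\ (forall x, S x -> S (adj x)).

Lemma maximal_commuting_star_set z : adj z = z -> exists M,
  [/\ commuting_star_set M, M z &
      forall N, commuting_star_set N -> M `<=` N -> N = M].
Proof.
move=> za.
(* Adjoining [z] inside the Zorn predicate secures [z] in the maximal set and covers the empty
   chain. *)
have [S [cS Smax]] : exists S, commuting_star_set (S `|` [set z]) /\
    forall B, S `<` B -> ~ commuting_star_set (B `|` [set z]).
  apply: Zorn_bigcup => F Fc Ftot; split.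
    move=> x y [[X FX Xx]|->] [[Y FY Yy]|->] //.
    - have [XY|YX] := Ftot X Y FX FY.
        by apply: (Fc Y FY).1; left => //; exact: XY.
      by apply: (Fc X FX).1; left => //; exact: YX.
    - by apply: (Fc X FX).1; [left|right].
    - by apply: (Fc Y FY).1; [right|left].
  move=> x [[X FX Xx]|->]; last by rewrite za; right.
  have [|xX|->] := (Fc X FX).2 x; first by left.
    by left; exists X.
  by right.
exists (S `|` [set z]); split=> //; first by right.
move=> N cN MN; apply: contrapT => NM.
have NE : N `|` [set z] = N.
  by apply/seteqP; split=> x; [case=> [//|->]; apply: MN; right | left].
apply: (Smax N); rewrite ?NE //; split; first by move=> x Sx; apply: MN; left.
by move=> NS; apply: NM; apply/seteqP; split=> // x Nx; left; exact: NS.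
Qed.

Section MaximalSets.
Variable M : set T.
Hypothesis cM : commuting_star_set M.
Hypothesis maxM : forall N, commuting_star_set N -> M `<=` N -> N = M.

Lemma maximal_mem x : (forall y, M y -> x * y = y * x) ->
  x * adj x = adj x * x -> M x.
Proof.
move=> xM xn; have xaM y : M y -> adj x * y = y * adj x.
  move=> My; rewrite -[LHS]adjK adjM adjK -xM ?adjM ?adjK //; exact: cM.2.
have <- : M `|` [set x; adj x] = M; last by right; left.
apply: maxM; last by move=> y; left.
split.
  move=> y y' [My|[->|->]] [My'|[->|->]] //; try by rewrite ?xM ?xaM.
  exact: cM.1.
move=> y [My|[->|->]]; first by left; exact: cM.2.
  by right; right.
by right; left; rewrite adjK.
Qed.

(** The second hypothesis, applied to [y = x], yields normality; it is easy to check when [adj x] is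
    built from elements of [M]. *)
Lemma maximal_normal_mem x : (forall y, M y -> x * y = y * x) ->
  (forall y, (forall u, M u -> y * u = u * y) -> y * adj x = adj x * y) -> M x.
Proof. by move=> xM xn; apply: maximal_mem => //; exact: xn. Qed.

Lemma maximal_subalgebra : @selfadjoint_subalgebra R A M.
Proof.
have comm := cM.1; have adM := cM.2.
split.
- by apply: maximal_mem => [y _|]; rewrite ?adj0 ?mul0r ?mulr0.
- move=> x y Mx My; apply: (@maximal_normal_mem (x + y)) => [u Mu|u uM].
    by rewrite mulrDl mulrDr !(comm _ u).
  by rewrite adjD mulrDl mulrDr !uM //; exact: adM.
- move=> c x Mx; apply: (@maximal_normal_mem (c *: (x : T))) => [u Mu|u uM].
    by rewrite -cstar_scalerAl -cstar_scalerAr (comm _ u).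
  by rewrite adjZ -cstar_scalerAl -cstar_scalerAr uM //; exact: adM.
- move=> x y Mx My; apply: (@maximal_normal_mem ((x : T) * y)) => [u Mu|u uM].
    by rewrite -mulrA (comm y u) // mulrA (comm x u) // mulrA.
  by rewrite adjM mulrA uM -?mulrA ?uM //; exact: adM.
- exact: adM.
Qed.

Lemma maximal_mem1 : M 1.
Proof. by apply: maximal_mem => [y _|]; rewrite ?adj1 ?mul1r ?mulr1. Qed.

Lemma maximal_commutative : @maximal_commutative_subalgebra R A M.
Proof.
split; first by split; [exact: maximal_subalgebra | exact: cM.1].
by move=> N [sN cN] MN; apply: maxM => //; split=> //; exact: subalg_adj.
Qed.

End MaximalSets.
End Windows.

(** * Approximation by finite combinations of orthogonal projections *)

Section Steps.
Context {R : realType} {A : cstarAlgType R}.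
Local Notation T := (cstar_ring A).
Implicit Types (x y z p e s t u v w : T) (c : R[i]) (S : set T).
Variable M : set T.
Hypothesis cM : commuting_star_set M.
Hypothesis sM : @selfadjoint_subalgebra R A M.
Hypothesis M1 : M 1.

Definition partition_of_unity (I : finType) (p : I -> T) :=
  [/\ forall i, M (p i), forall i, projection (p i),
      forall i j, i != j -> p i * p j = 0 & \sum_i p i = 1].

(** The counterpart of simple functions; since the projections sum to 1, products of two partitions
    form a common refinement. *)
Definition step x := exists (I : finType) (p : I -> T) (l : I -> R[i]),
  partition_of_unity p /\ x = \sum_i l i *: p i.

Lemma selfadjoint_subalgebraB x y : M x -> M y -> M (x - y).
Proof.
move=> Mx My; rewrite -scaleN1r; apply: (subalgD sM) => //.
exact: (subalgZ sM).
Qed.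

Lemma step_mul_sum (I : finType) (p : I -> T) (l : I -> R[i]) i :
  (forall i j, i != j -> p i * p j = 0) -> (forall i, projection (p i)) ->
  (\sum_j l j *: p j) * p i = l i *: p i.
Proof.
move=> po pp; rewrite mulr_suml (bigD1 i) //= -cstar_scalerAl (proj_idem (pp i)).
by rewrite big1 ?addr0 // => j ji; rewrite -cstar_scalerAl po // scaler0.
Qed.

Lemma step_refine x y : step x -> step y ->
  exists (I : finType) (p : I -> T) (l m : I -> R[i]),
  [/\ partition_of_unity p, x = \sum_i l i *: p i & y = \sum_i m i *: p i].
Proof.
move=> [I [p [l [[Mp pp po p1] ->]]]] [J [q [m [[Mq pq qo q1] ->]]]].
exists (I * J)%type, (fun ij => p ij.1 * q ij.2), (fun ij => l ij.1), (fun ij => m ij.2).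
have pqC i j : p i * q j = q j * p i by exact: cM.1.
split.
- split.
  + by move=> [i j]; apply: (subalgM sM).
  + move=> [i j]; split=> /=.
      by rewrite /selfadjoint adjM (adj_proj (pp i)) (adj_proj (pq j)) pqC.
    by rewrite mulrA -(mulrA (p i)) -pqC mulrA (proj_idem (pp i)) -mulrA (proj_idem (pq j)).
  + move=> [i j] [i' j'] ij /=; rewrite mulrA -(mulrA (p i)) -pqC mulrA.
    have [ii|ii] := eqVneq i i'; last by rewrite po // !mul0r.
    rewrite -mulrA qo ?mulr0 //; apply: contraNneq ij => ->.
    by rewrite ii.
  + rewrite -(pair_bigA _ (fun i j => p i * q j)) /= -[RHS]p1; apply: eq_bigr => i _.
    by rewrite -mulr_sumr q1 mulr1.
- rewrite -(pair_bigA _ (fun i j => l i *: (p i * q j))) /=; apply: eq_bigr => i _.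
  by rewrite -scaler_sumr -mulr_sumr q1 mulr1.
- rewrite -(pair_bigA _ (fun i j => m j *: (p i * q j))) /= exchange_big /=.
  by apply: eq_bigr => j _; rewrite -scaler_sumr -mulr_suml p1 mul1r.
Qed.

Lemma step_proj e : M e -> projection e -> step e.
Proof.
move=> Me pe; exists bool, (fun b : bool => if b then e else 1 - e),
  (fun b : bool => if b then 1 else 0).
split; last by rewrite big_bool /= scale1r scale0r addr0.
split.
- by case=> //; exact: selfadjoint_subalgebraB.
- by case=> //; exact: projC.
- case=> [] [] // _; first by rewrite mulrBr mulr1 (proj_idem pe) subrr.
  by rewrite mulrBl mul1r (proj_idem pe) subrr.
- by rewrite big_bool /= addrC subrK.
Qed.

Lemma stepD x y : step x -> step y -> step (x + y).
Proof.
move=> sx sy; have [I [p [l [m [pu -> ->]]]]] := step_refine sx sy.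
exists I, p, (fun i => l i + m i); split=> //.
by rewrite -big_split /=; apply: eq_bigr => i _; rewrite scalerDl.
Qed.

Lemma stepM x y : step x -> step y -> step (x * y).
Proof.
move=> sx sy; have [I [p [l [m [pu -> ->]]]]] := step_refine sx sy.
exists I, p, (fun i => l i * m i); split=> //; have [_ pp po _] := pu.
rewrite mulr_sumr; apply: eq_bigr => i _.
by rewrite -cstar_scalerAr step_mul_sum // scalerA mulrC.
Qed.

Lemma stepZ c x : step x -> step (c *: x).
Proof.
move=> [I [p [l [pu ->]]]]; exists I, p, (fun i => c * l i); split=> //.
by rewrite scaler_sumr; apply: eq_bigr => i _; rewrite scalerA.
Qed.

Lemma step_adj x : step x -> step (adj x).
Proof.
move=> [I [p [l [pu ->]]]]; exists I, p, (fun i => Num.conj (l i)); split=> //.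
have [_ pp _ _] := pu.
rewrite (big_morph adj (id1 := 0) (op1 := +%R)) => [|y z|]; rewrite ?adjD ?adj0 //.
by apply: eq_bigr => i _; rewrite adjZ (adj_proj (pp i)).
Qed.

Definition step_approx x := forall c, 0 < c -> exists2 y, step y & `|x - y| < c.

Lemma step_step_approx x : step x -> step_approx x.
Proof. by move=> sx c c0; exists x => //; rewrite subrr normr0. Qed.

Lemma step_approx_subalgebra : @selfadjoint_subalgebra R A step_approx.
Proof.
split.
- apply: step_step_approx; rewrite -(scale0r (1 : T)); apply: stepZ.
  by apply: step_proj => //; exact: projection1.
- move=> x y ax ay c c0.
  have c2 : 0 < c / 2 by rewrite divr_gt0 ?ltr0n.
  have [x' sx xx'] := ax _ c2; have [y' sy yy'] := ay _ c2.
  exists (x' + y'); first exact: stepD.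
  have -> : (x : T) + y - (x' + y') = (x - x') + (y - y') by rewrite opprD addrACA.
  by rewrite (splitr c); apply: le_lt_trans (ler_normD _ _) _; exact: ltrD.
- move=> c x ax d d0.
  have nc : 0 < `|c| + 1 by rewrite ltr_wpDl.
  have [x' sx xx'] := ax _ (divr_gt0 d0 nc); exists (c *: x'); first exact: stepZ.
  have -> : c *: (x : T) - c *: x' = c *: ((x : T) - x') by rewrite scalerBr.
  rewrite normrZc; move: xx'; rewrite ltr_pdivlMr // => xx'.
  by apply: le_lt_trans xx'; rewrite mulrC ler_wpM2l // lerDl.
- move=> x y ax ay c c0.
  have c2 : 0 < c / 2 by rewrite divr_gt0 ?ltr0n.
  have nx : 0 < `|x| + 1 by rewrite ltr_wpDl.
  (* [y'] is chosen first because the tolerance for [x'] depends on its norm; the added 1 keeps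
     denominators positive. *)
  have [y' sy yy'] := ay _ (divr_gt0 c2 nx).
  have ny : 0 < `|y'| + 1 by rewrite ltr_wpDl.
  have [x' sx xx'] := ax _ (divr_gt0 c2 ny).
  exists (x' * y'); first exact: stepM.
  have -> : (x : T) * y - x' * y' = (x : T) * ((y : T) - y') + ((x : T) - x') * y'.
    by rewrite mulrBr mulrBl addrA subrK.
  rewrite (splitr c); apply: le_lt_trans (ler_normD _ _) _; apply: ltrD.
    apply: le_lt_trans (norm_mul_le _ _) _; move: yy'; rewrite ltr_pdivlMr //.
    by apply: le_lt_trans; rewrite mulrC ler_wpM2l // lerDl.
  apply: le_lt_trans (norm_mul_le _ _) _; move: xx'; rewrite ltr_pdivlMr //.
  by apply: le_lt_trans; rewrite ler_wpM2l // lerDl.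
- move=> x ax c c0; have [y sy xy] := ax _ c0; exists (adj y); first exact: step_adj.
  suff : `|adj (x : T) - adj y| < c by [].
  by rewrite -adjB norm_adj.
Qed.

Lemma step_approx_closed : closed (step_approx : set A).
Proof.
move=> x xcl c c0.
have c2 : 0 < c / 2 by rewrite divr_gt0 ?ltr0n.
have [y [ay]] := xcl _ (nbhsx_ballx (x : A) _ c2); rewrite -ball_normE /= => xy.
have [y' sy yy'] := ay _ c2; exists y' => //.
have -> : (x : T) - y' = ((x : T) - y) + ((y : T) - y') by rewrite addrA subrK.
by rewrite (splitr c); apply: le_lt_trans (ler_normD _ _) _; exact: ltrD.
Qed.

Lemma generated_step_approx z :
  @generated_subalgebra R A [set e | M e /\ @projection T e] z -> step_approx z.
Proof.
move=> gz; apply: (gz step_approx); split.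
  by split; [exact: step_approx_subalgebra | exact: step_approx_closed].
by move=> e [Me pe]; apply: step_step_approx; exact: step_proj.
Qed.

(* A real combination with coefficients in [-1, 1] is the real part of a unitary
   one, hence has norm at most 1. *)
Lemma step_norm_le (I : finType) (p : I -> T) (l : I -> R[i]) c :
  partition_of_unity p -> (forall i, l i \is Num.real) ->
  (forall i, `|l i| <= c) -> 0 < c -> `|\sum_i l i *: p i| <= c.
Proof.
move=> [_ pp po p1] lr lc c0.
have [m mE] : exists m, forall i, m i = l i / c by exists (fun i => l i / c).
have mr i : m i \is Num.real by rewrite mE realM // realV gtr0_real.
have m1 i : 0 <= 1 - m i ^+ 2.
  rewrite subr_ge0 -real_normK // expr_le1 // mE normrM normfV (gtr0_norm c0).
  by rewrite ler_pdivrMr // mul1r.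
pose a i := m i + 'i * sqrtC (1 - m i ^+ 2).
have conja i : Num.conj (a i) = m i - 'i * sqrtC (1 - m i ^+ 2).
  rewrite rmorphD rmorphM /= conjCi (conj_Creal (mr i)) conj_Creal ?sqrtC_real //.
  by rewrite mulNr.
have aa i : Num.conj (a i) * a i = 1.
  rewrite conja /a -subr_sqr exprMn sqrCi sqrtCK mulN1r opprK.
  by rewrite addrC subrK.
pose u := \sum_i a i *: p i.
have ua : adj u = \sum_i Num.conj (a i) *: p i.
  rewrite (big_morph adj (id1 := 0) (op1 := +%R)) => [|y z|]; rewrite ?adjD ?adj0 //.
  by apply: eq_bigr => i _; rewrite adjZ (adj_proj (pp i)).
have uu : adj u * u = 1.
  rewrite ua /u mulr_sumr -[RHS]p1; apply: eq_bigr => i _.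
  by rewrite -cstar_scalerAr step_mul_sum // scalerA mulrC aa scale1r.
have u1 := norm_isometry_le1 uu.
have -> : \sum_i l i *: p i = (c * 2^-1) *: (u + adj u).
  rewrite ua /u -big_split scaler_sumr /=; apply: eq_bigr => i _.
  rewrite -scalerDl scalerA conja /a addrACA subrr addr0 -mulrA mulrDr.
  rewrite -mulrDl half1 mul1r mE mulrC divfK //.
  by rewrite gt_eqF.
have c0' := ltW c0; have cc : 0 <= c * 2^-1 by rewrite mulr_ge0 ?half_inv_ge0.
rewrite normrZc (ger0_norm cc) -[leRHS]mulr1 -mulrA ler_wpM2l //.
rewrite mulrC ler_pdivrMr ?ltr0n //.
apply: le_trans (ler_normD _ _) _; rewrite norm_adj mul1r -[leRHS]natr1.
exact: lerD.
Qed.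

End Steps.

(** * AW*-algebras are Baer *)

Section AWStarProperties.
Context {R : realType} {A : cstarAlgType R}.
Local Notation T := (cstar_ring A).
Implicit Types (x y z p e s t u v w : T) (c : R[i]).
Hypothesis hA : AWstar A.

(* The window p is one of the projections in a finite approximation of z inside a
   maximal commutative subalgebra. *)
Lemma spectral_window z v : adj z = z -> v * z <> 0 ->
  exists p (l : R[i]), [/\ projection p, p * z = z * p, v * p <> 0
    & [/\ l \is Num.real, l != 0 & `|l *: p - z * p| <= 2^-1 * `|l| ]].
Proof.
move=> za vz; apply: contrapT => nwin.
have [M [cM Mz maxM]] := maximal_commuting_star_set za.
have sM := maximal_subalgebra cM maxM; have M1 := maximal_mem1 cM maxM.
have d0 : 0 < `|v * z| by rewrite normr_gt0; apply/eqP.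
have v0 : 0 < `|v|.
  rewrite normr_gt0; apply/negP => /eqP v0; apply: vz; rewrite v0.
  exact: mul0r.
(* With this [e], the absence of a window gives [|v z| <= |v| e + |v| (2 e)], which is three
   quarters of [|v z|]. *)
pose e := `|v * z| / (4 * `|v|).
have e0 : 0 < e by rewrite divr_gt0 // mulr_gt0 ?ltr0n.
have [y sy zy] : exists2 y, step M y & `|z - y| < e.
  have := generated_step_approx cM sM M1; apply => //.
  by rewrite -(hA.2 _ (maximal_commutative cM maxM)).
have [I [p [l [pu yE]]]] := sy; have [Mp pp po p1] := pu.
(* As [z] is self-adjoint, replacing [y] by its self-adjoint part does not spoil the
   approximation. *)
pose r i := 'Re (l i).
have rr i : r i \is Num.real := Creal_Re _.
pose y1 := \sum_i r i *: p i.
have zy1 : `|z - y1| <= e.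
  have -> : z - y1 = 2^-1 *: ((z - y) + adj (z - y)).
    rewrite adjB za addrACA -opprD scalerBr.
    rewrite (scalerDr _ z) -scalerDl half1 scale1r; congr (_ - _).
    rewrite /y1 yE (big_morph adj (id1 := 0) (op1 := +%R)) => [|a b|]; rewrite ?adjD ?adj0 //.
    rewrite -big_split scaler_sumr /=; apply: eq_bigr => i _.
    rewrite adjZ (adj_proj (pp i)) -scalerDl scalerA; congr (_ *: _).
    by rewrite /r ReE mulrC.
  rewrite normrZc ger0_norm ?half_inv_ge0 // mulrC ler_pdivrMr ?ltr0n //.
  apply: le_trans (ler_normD _ _) _; rewrite norm_adj mulrDr mulr1.
  by apply: lerD; exact: ltW.
(* Beyond [2 * e] the error [e] is at most half the coefficient, so [p i] would be a window unless
   [v] kills it. *)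
have small i : ~~ (`|r i| <= 2 * e) -> v * p i = 0.
  rewrite -real_ltNge ?normr_real //; last by rewrite realM ?realn // gtr0_real.
  move=> ri; apply: contrapT => vp; apply: nwin; exists (p i), (r i).
  have r0 : 0 < `|r i| by apply: lt_trans ri; rewrite mulr_gt0 ?ltr0n.
  split=> //; first exact: cM.1.
  split=> //; first by rewrite -normr_gt0.
  rewrite -(step_mul_sum r i po pp) -/y1 -mulrBl -opprB mulNr normrN.
  apply: le_trans (norm_mul_le _ _) _; rewrite -[leRHS]mulr1.
  apply: ler_pM => //; last exact: norm_proj_le1.
  by apply: le_trans zy1 _; rewrite mulrC ler_pdivlMr ?ltr0n // mulrC ltW.
pose m i := if `|r i| <= 2 * e then r i else 0.
have vy : v * y1 = v * \sum_i m i *: p i.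
  rewrite /y1 !mulr_sumr; apply: eq_bigr => i _; rewrite /m; case: ifP => // /negbT.
  by rewrite -!cstar_scalerAr => /small ->; rewrite !scaler0.
have my : `|\sum_i m i *: p i| <= 2 * e.
  apply: (step_norm_le pu).
  - by move=> i; rewrite /m; case: ifP => // _; exact: real0.
  - move=> i; rewrite /m; case: ifP => // _.
    by rewrite normr0 mulr_ge0 // ltW.
  - by rewrite mulr_gt0 ?ltr0n.
have : `|v * z| < `|v * z|; last by rewrite ltxx.
rewrite {1}(_ : v * z = v * (z - y1) + v * \sum_i m i *: p i); last first.
  by rewrite -vy mulrBr subrK.
apply: le_lt_trans (ler_normD _ _) _.
apply: (@le_lt_trans _ _ (`|v| * e + `|v| * (2 * e))).
  by apply: lerD; apply: le_trans (norm_mul_le _ _) _; rewrite ler_wpM2l.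
have -> : `|v * z| = `|v| * (4 * e).
  rewrite mulrA (mulrC `|v|) /e mulrCA mulfV ?mulr1 //.
  by rewrite gt_eqF // mulr_gt0 ?ltr0n.
rewrite -mulrDr ltr_pM2l // -{1}(mul1r e) -mulrDl ltr_pM2r //.
by rewrite -[X in X + _]/(1%:R) -natrD ltr_nat.
Qed.

(** On the corner of [p], [z / l] is within 1/2 of the identity; this is the form used by
    [inverse_near1] and [sqrt_near1]. *)
Lemma window_inverse z p (l : R[i]) : projection p -> adj z = z -> p * z = z * p ->
  l \is Num.real -> l != 0 -> `|l *: p - z * p| <= 2^-1 * `|l| ->
  exists t, [/\ adj t = t, `|t| <= 2^-1, p * t = t, t * p = t & z * p = l *: (p - t)].
Proof.
move=> pp za pz lr l0 le; exists (p - l^-1 *: (z * p)).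
have zpa : adj (z * p) = z * p by rewrite adjM za (adj_proj pp) pz.
have pzp : p * (z * p) = z * p by rewrite mulrA pz -mulrA (proj_idem pp).
split.
- rewrite adjB adjZ zpa (adj_proj pp) conj_Creal //.
  by rewrite realV.
- have -> : p - l^-1 *: (z * p) = l^-1 *: (l *: p - z * p).
    by rewrite scalerBr scalerA mulVf // scale1r.
  rewrite normrZc normfV mulrC ler_pdivrMr ?normr_gt0 //.
- by rewrite mulrBr (proj_idem pp) -cstar_scalerAr pzp.
- by rewrite mulrBl (proj_idem pp) -cstar_scalerAl -mulrA (proj_idem pp).
- by rewrite opprB addrC subrK scalerA mulfV // scale1r.
Qed.

Lemma projection_below z : adj z = z -> z <> 0 ->
  exists p k, [/\ projection p, p <> 0 & p = z * k].
Proof.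
move=> za z0; have [|p [l [pp pz p0 [lr l0 le]]]] := @spectral_window z 1 za.
  by rewrite mul1r.
have [t [ta t2 pt tp zp]] := window_inverse pp za pz lr l0 le.
have [k [_ tk]] := inverse_near1 t2.
exists p, (p * (l^-1 *: k)); split=> //; first by move=> p0'; apply: p0; rewrite mul1r.
rewrite mulrA zp -cstar_scalerAr -cstar_scalerAl scalerA mulVf // scale1r.
have -> : p - t = p * (1 - t) by rewrite mulrBr mulr1 pt.
by rewrite -mulrA tk mulr1.
Qed.

(** If [x * e] were nonzero, a nonzero projection [p] in the right ideal of [adj (x * e) * (x * e)]
    would lie below [e] and be orthogonal to [S], and [e - p] would be a smaller upper bound. *)
Lemma orthogonal_lub_annihilator (S : set T) e x :
  (forall f, S f -> projection f) -> proj_lub S e ->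
  (forall f, S f -> x * f = 0) -> x * e = 0.
Proof.
move=> Sp [pe Se emin] xS; apply: contrapT => xe.
pose z := adj (x * e) * (x * e).
have za : adj z = z by rewrite adjM adjK.
have [|p [k [pp p0 pE]]] := projection_below za.
  by move=> /cstar_mul_eq0.
have ep : e * p = p by rewrite pE /z adjM (adj_proj pe) !mulrA (proj_idem pe).
have pe' := proj_leR pp pe ep.
have fp f : S f -> f * p = 0.
  move=> Sf; have fe : f * e = f := Se f Sf.
  have fx : f * adj x = 0 by rewrite -(adj_proj (Sp f Sf)) -adjM xS // adj0.
  by rewrite pE /z !adjM (adj_proj pe) !mulrA fe fx !mul0r.
have : e * (e - p) = e.
  apply: emin; first exact: projB.
  move=> f Sf; rewrite /proj_le mulrBr (fp f Sf) subr0; exact: Se.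
rewrite mulrBr (proj_idem pe) ep => /eqP; rewrite -subr_eq0 addrAC subrr add0r.
by rewrite oppr_eq0 => /eqP.
Qed.

(** The generator is the supremum of a maximal orthogonal family of nonzero projections annihilated
    by [S]. If [x] is annihilated but not fixed by [e], a projection in the right ideal of
    [x - e * x] enlarges the family. *)
Lemma AWstar_baer : baer T.
Proof.
move=> S.
pose fam (F : set T) := (forall e, F e -> [/\ projection e, e <> 0 &
   forall s, S s -> s * e = 0]) /\ (forall e f, F e -> F f -> e <> f -> e * f = 0).
have [F [[Fp Fo] Fmax]] : exists F, fam F /\ forall B, F `<` B -> ~ fam B.
  apply: Zorn_bigcup => C Cfam Ctot; split.
    by move=> e [X CX Xe]; exact: (Cfam X CX).1.
  move=> e f [X CX Xe] [Y CY Yf] ef.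
  have [XY|YX] := Ctot X Y CX CY.
    by apply: (Cfam Y CY).2 => //; exact: XY.
  by apply: (Cfam X CX).2 => //; exact: YX.
have pF e : F e -> projection e by move=> /Fp[].
have [e lub_e] := hA.1 F pF Fo; have [pe Fe _] := lub_e.
have Se s : S s -> s * e = 0.
  move=> Ss; apply: (orthogonal_lub_annihilator pF lub_e) => f /Fp[_ _].
  exact.
exists e; split=> // x; split=> [Sx|ex s Ss]; last by rewrite -ex mulrA Se // mul0r.
apply: contrapT => ex.
have [x1 x1E] : exists x1, x1 = x - e * x by exists (x - e * x).
have ex1 : e * x1 = 0 by rewrite x1E mulrBr mulrA (proj_idem pe) subrr.
have Sx1 s : S s -> s * x1 = 0.
  by move=> Ss; rewrite x1E mulrBr (Sx s Ss) (mulrA s) (Se s Ss) mul0r subr0.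
have [||p [k [pp p0 pE]]] := @projection_below (x1 * adj x1).
- by rewrite adjM adjK.
- rewrite -{1}(adjK x1) => /cstar_mul_eq0 /adj_eq0; rewrite x1E => /eqP.
  by rewrite subr_eq0 eq_sym => /eqP.
have ep : e * p = 0 by rewrite pE !mulrA ex1 !mul0r.
have fp f : F f -> f * p = 0.
  by move=> Ff; have fe : f * e = f := Fe f Ff; rewrite -fe -mulrA ep mulr0.
have pf f : F f -> p * f = 0 by move=> Ff; apply: (proj_orthC (pF f Ff) pp (fp f Ff)).
apply: (Fmax (F `|` [set p])).
  split; first by move=> f Ff; left.
  by move=> /(_ p (or_intror erefl)) /fp; rewrite (proj_idem pp).
split.
  move=> f [/Fp//|->]; split=> // s Ss.
  by rewrite pE !mulrA Sx1 // !mul0r.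
move=> f g [Ff|->] [Fg|->] fg //; [exact: Fo|exact: fp|exact: pf].
Qed.

Lemma cstar_half : half_element (2^-1 *: (1 : T)).
Proof.
split; first by rewrite -scalerDl half1 scale1r.
  by rewrite adjZ adj1 conj_half.
by move=> x; rewrite -cstar_scalerAl -cstar_scalerAr mul1r mulr1.
Qed.

(** On a window [p] of [z = adj y * y] one has [z * p = l p (1 - q)^2] with [k] inverse to [1 - q];
    the partial isometry is [y * p * k] divided by a square root of [l]. *)
Lemma AWstar_local_polar : local_polar T.
Proof.
move=> s t y v ps pt st tys.
have [z zE] : exists z, z = adj y * y by exists (adj y * y).
have za : adj z = z by rewrite zE adjM adjK.
have ys : y * s = y by rewrite -{1}tys -mulrA (proj_idem ps).
have ty : t * y = y by rewrite -{1}tys !mulrA (proj_idem pt).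
have zs : z * s = z by rewrite zE -mulrA ys.
have sz : s * z = z by rewrite -{1}za -{1}(adj_proj ps) -adjM zs.
rewrite -zE => vz.
have [p [l [pp pz vp [lr l0 le]]]] := spectral_window za vz.
have [r [ra r2 pr rp zp]] := window_inverse pp za pz lr l0 le.
have [q [qa q2 qq qC]] := sqrt_near1 ra r2.
have pq : p * q = q * p by apply: qC; rewrite ?pr ?rp.
have [k [kq qk]] := inverse_near1 q2.
have ka : adj k = k.
  have : adj k * (1 - q) = 1.
    by rewrite -{1}qa -{1}adj1 -adjB -adjM qk adj1.
  by move=> E; rewrite -[LHS]mulr1 -qk mulrA E mul1r.
have p1q : p * (1 - q) = (1 - q) * p by rewrite mulrBr mulrBl mulr1 mul1r pq.
have pk : p * k = k * p.
  by rewrite -[LHS]mul1r -kq -mulrA (mulrA (1 - q)) -p1q -mulrA qk mulr1.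
have zpE : z * p = l *: (p * ((1 - q) * (1 - q))).
  by rewrite zp qq mulrBr mulr1 pr.
have kzpk : k * (z * p) * k = l *: p.
  rewrite zpE -cstar_scalerAr -cstar_scalerAl (mulrA k p) -pk.
  by rewrite -!mulrA qk mulr1 kq mulr1.
have sp : s * p = p.
  have zpkk : z * p * k * k = l *: p.
    rewrite zpE -!cstar_scalerAl -!mulrA (mulrA (1 - q) k) qk mul1r qk.
    by rewrite mulr1.
  have : l *: (s * p) = l *: p by rewrite cstar_scalerAr -zpkk !mulrA sz.
  move=> /(congr1 (fun x => l^-1 *: x)).
  by rewrite !scalerA mulVf // !scale1r.
have ps' := proj_leR pp ps sp.
have pt0 : p * t = 0 by rewrite -ps' -mulrA st mulr0.
have [w0 w0E] : exists w0, w0 = y * p * k by exists (y * p * k).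
have w00 : adj w0 * w0 = l *: p.
  rewrite w0E !adjM ka (adj_proj pp) !mulrA -(mulrA (k * p)) -zE -(mulrA k p) pz.
  by rewrite -(mulrA k (z * p)) -(mulrA z) (proj_idem pp) kzpk.
have pw0 : p * w0 = 0 by rewrite w0E -ty !mulrA pt0 !mul0r.
have wp0 : adj w0 * p = 0 by rewrite -(adj_proj pp) -adjM pw0 adj0.
(* Were [l] negative, [c * c = - l] would give [c *: p + w0] zero square norm, because [p * w0 = 0]
   by orthogonality of [s] and [t]; then [p = 0]. *)
have lpos : 0 < l.
  rewrite real_ltNge ?real0 //; apply/negP => l0'.
  have nl : 0 <= - l by rewrite oppr_ge0.
  have [c [cc cr]] : exists c : R[i], c * c = - l /\ Num.conj c = c.
    exists (sqrtC (- l)); rewrite -expr2 sqrtCK conj_Creal //.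
    exact: sqrtC_real.
  have x0 : c *: p + w0 = 0.
    apply: cstar_mul_eq0; rewrite adjD adjZ (adj_proj pp) cr mulrDl !mulrDr.
    rewrite -!cstar_scalerAl -!cstar_scalerAr pw0 wp0 w00 !scaler0 addr0 add0r.
    by rewrite (proj_idem pp) scalerA cc scaleNr addrC subrr.
  have : p * (c *: p + w0) = 0 by rewrite x0 mulr0.
  rewrite mulrDr pw0 addr0 -cstar_scalerAr (proj_idem pp) => cp.
  apply: vp; have := congr1 (fun x => c *: x) cp.
  rewrite scaler0 scalerA cc => lp.
  have := congr1 (fun x => (- l)^-1 *: x) lp.
  rewrite scalerA mulVf ?oppr_eq0 // scale1r scaler0 => ->.
  exact: mulr0.
have [c [cc cr c0]] : exists c : R[i], [/\ c * c = l, c \is Num.real & c != 0].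
  exists (sqrtC l); rewrite -expr2 sqrtCK sqrtC_eq0; split=> //.
  by apply: sqrtC_real; exact: ltW.
have cV : Num.conj c^-1 = c^-1 by apply: conj_Creal; rewrite realV.
exists p, (c^-1 *: w0), (c^-1 *: (p * k)), (c *: (1 - q)); split=> //; split.
- rewrite adjZ cV -cstar_scalerAl -cstar_scalerAr w00 !scalerA -invfM cc.
  by rewrite mulVf // scale1r.
- by rewrite w0E -cstar_scalerAr mulrA.
- by rewrite -cstar_scalerAr mulrA (proj_idem pp).
- rewrite -cstar_scalerAl -cstar_scalerAr scalerA mulVf // scale1r w0E.
  by rewrite -(mulrA (y * p)) kq mulr1.
Qed.

End AWStarProperties.

(** * The characterization *)

Lemma almost_star_clean_finite (R : realType) (A : cstarAlgType R) :
  almost_star_clean (cstar_ring A) -> finite_algebra (cstar_ring A).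
Proof.
move=> clean; split; first exact: projection1.
move=> f pf _ [v [_ vv vf]].
have [b [e [[_ binj] pe be]]] := clean (v + v).
(* Multiplying [b = 2v - e] on the left by half of [adj v] gives 1 minus this element, whose norm is
   at most 1/2. *)
have [|k [kl _]] := @inverse_near1 _ A (2^-1 *: (adj v * e)).
  rewrite normrZc ger0_norm ?half_inv_ge0 // -[leRHS]mulr1 ler_wpM2l ?half_inv_ge0 //.
  apply: le_trans (norm_mul_le _ _) _; rewrite norm_adj -[leRHS]mulr1.
  by apply: ler_pM => //; [exact: norm_isometry_le1 | exact: norm_proj_le1].
pose g := k * (2^-1 *: adj v).
have gb : g * b = 1.
  have -> : b = v + v - e by rewrite be addrK.
  rewrite -kl /g -mulrA; congr (_ * _).
  rewrite -cstar_scalerAl mulrBr mulrDr vv scalerBr; congr (_ - _).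
  by rewrite scalerDr -scalerDl half1 scale1r.
have bg : b * g = 1.
  apply/eqP; rewrite -subr_eq0; apply/eqP/binj.
  by rewrite mulrBl mul1r -mulrA gb mulr1 subrr.
have vf0 : adj v * (1 - f) = 0 by rewrite mulrBr mulr1 -vf mulrA vv mul1r subrr.
apply/esym/eqP; rewrite -subr_eq0 -[X in X == 0]mul1r -{1}bg /g -!mulrA.
by rewrite -cstar_scalerAl vf0 scaler0 !mulr0.
Qed.

Theorem theorem4p3 (R : realType) (A : cstarAlgType R) (hA : AWstar A) :
  almost_star_clean (cstar_ring A) <-> finite_algebra (cstar_ring A).
Proof.
split; first exact: almost_star_clean_finite.
move=> fin; apply: finite_almost_star_clean fin.
- exact: AWstar_baer.
- exact: cstar_half.
- exact: AWstar_local_polar.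
Qed.
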